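(* Let $f:\mathbb{D}\to\mathbb{C}$ be a bounded analytic function on the open unit disk. Let $\gamma_1,\gamma_2,\gamma_3$ be paths (in $\mathbb{D}$ from $-1$ to $1$) such that the limit of $f$ exists along $\gamma_1$ and along $\gamma_2$, and does not exist along $\gamma_3$. Then the following hold. \begin{itemize} \item The region between $\gamma_1$ and $\gamma_2$ is a convergence set for $f$ at $1$. \item Either the region above $\gamma_3$ or the region below $\gamma_3$ is a path divergence set for $f$ at $1$. \end{itemize}
   Context: $\mathbb{D}$ is the open unit disk in $\mathbb{C}$. A path is a continuous map $\gamma:[0,1]\to\mathbb{C}$ with $\gamma(0)=-1$, $\gamma(1)=1$, and $\gamma(s)\in\mathbb{D}$ for all $s\in(0,1)$; it need not be injective. The symbol $\gamma$ also denotes the trace $\gamma([0,1])$ as a subset of the plane. The limit of $f$ along $\gamma$ is $\lim_{s\to1^-}f(\gamma(s))$ (a limit in $\mathbb{C}$, if it exists). Complements $(\cdot)^c$ are taken in $\mathbb{C}$. Let $K\subset\mathbb{D}$ be a set with $1\in\partial K$. $K$ is a convergence set for $f$ at $1$ if $\lim_{z\to1,\,z\in K}f(z)$ exists. $K$ is a path divergence set for $f$ at $1$ if for every path $\gamma\subset K$ (meaning $\gamma(s)\in K$ for all $s\in(0,1)$), the limit $\lim_{s\to1^-}f(\gamma(s))$ does not exist. The region between two paths $\gamma_1$ and $\gamma_2$ is the set of all points $z\in\mathbb{D}$ such that $z$ is in $\gamma_1$, or $z$ is in $\gamma_2$, or $z$ is in a bounded component of $(\gamma_1\cup\gamma_2)^c$.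 For a path $\gamma_3$, the region above $\gamma_3$ is the component of $\mathbb{D}\setminus\gamma_3$ which contains $i$ in its boundary, and the region below $\gamma_3$ is the component of $\mathbb{D}\setminus\gamma_3$ which contains $-i$ in its boundary. *)

(* Defs.v *)
From HB Require Import structures.
From mathcomp Require Import all_boot all_order all_algebra.
From mathcomp Require Import complex.
From mathcomp Require Import all_classical all_reals all_analysis.

Set Implicit Arguments.
Unset Strict Implicit.
Unset Printing Implicit Defensive.

Import Order.TTheory GRing.Theory Num.Theory.
Import numFieldNormedType.Exports.

Local Open Scope classical_set_scope.
Local Open Scope ring_scope.

(* The topology, norm and derivative on [R[i]^o] are those of a numFieldType
   seen as a normed module over itself; since [e > 0] in [R[i]] forces [e] to be
   real, this is the usual topology of the complex plane, and [derivable f z 1]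
   is complex differentiability of [f] at [z]. *)
Notation Cplane R := (R[i]^o).

Section Plane.
Variable R : realType.
Local Notation C := (Cplane R).

Definition disk : set C := [set z | `|z| < 1].

Definition analytic_on_disk (f : C -> C) : Prop :=
  forall z, disk z -> derivable f z 1.

Definition boundary (A : set C) : set C := closure A `\` interior A.

(* Only the values of [g] on [0, 1] are constrained or used. *)
Definition is_path (g : R -> C) : Prop :=
  [/\ {within `[0, 1], continuous g}, g 0 = -1, g 1 = 1 &
      forall s, 0 < s < 1 -> disk (g s)].

Definition trace (g : R -> C) : set C := g @` `[0, 1].

Definition has_limit_along (f : C -> C) (g : R -> C) : Prop :=
  exists l : C, f (g s) @[s --> 1^'-] --> l.

Definition convergence_set (f : C -> C) (K : set C) : Prop :=
  [/\ K `<=` disk, boundary K 1 &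
      exists l : C, f z @[z --> within K (nbhs (1 : C))] --> l].

Definition path_divergence_set (f : C -> C) (K : set C) : Prop :=
  [/\ K `<=` disk, boundary K 1 &
      forall g : R -> C, is_path g -> (forall s, 0 < s < 1 -> K (g s)) ->
        ~ has_limit_along f g].

Definition in_bounded_component (A : set C) (z : C) : Prop :=
  A z /\ bounded_set (connected_component A z).

Definition region_between (g1 g2 : R -> C) : set C :=
  [set z | disk z /\
    [\/ trace g1 z, trace g2 z |
        in_bounded_component (~` (trace g1 `|` trace g2)) z]].

(* The trace of a path is compact and misses the points [i] and [-i], so a
   small half-disk at either point lies in a single component of the
   complement: exactly one component has that point in its boundary, and the
   set of all points whose component has this property is that component. *)
Definition component_touching (g : R -> C) (p : C) : set C :=
  [set z | (disk `\` trace g) z /\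
    boundary (connected_component (disk `\` trace g) z) p].

Definition region_above (g : R -> C) : set C := component_touching g 'i%C.

Definition region_below (g : R -> C) : set C := component_touching g (- 'i%C).

End Plane.

(* Main.v *)
Require Import Defs.
From HB Require Import structures.
From mathcomp Require Import all_boot all_order all_algebra.
From mathcomp Require Import complex.
From mathcomp Require Import all_classical all_reals all_analysis.
From mathcomp Require Import zify ring lra.

(** The analytic core is a maximum principle near the point [1]. If a bounded
    analytic function tends to [0] along two paths, it tends to [0] at [1] in
    every region that they enclose, because the boundary of such a region lies
    on the two paths; only the point [1] and the part of the boundary far from
    [1] have to be neutralised, with the factors [1 - z] and [(1 + z) / 2]
    ([small_between]). The maximum principle itself ([max_principle]) is derived
    from Goursat's theorem for rectangles.

    Two paths with limits [a] and [b] must have [a = b]. Indeed a path and its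
    mirror image in the real axis enclose the diameter ([diameter_between]), so
    that [small_between], applied to the product of [f - a] and its reflection,
    shows that [a] is also the radial limit of [f] ([radial_limit]). With [a = b],
    applying [small_between] to [f - a] gives the first claim ([limit_between]).

    For the second claim, suppose that paths [ga] above and [gb] below the third
    path both have limits. Then the third path lies in the region between [ga]
    and [gb] ([path_between_sides]), and by the first claim [f] has a limit along
    it, contrary to the hypothesis.

    The plane topology behind this is that a path in the disk from [-1] to [1]
    separates the upper arc of the circle from the lower one
    ([disk_separation]). It comes from the fact that two paths joining opposite
    sides of a rectangle meet ([paths_cross]), which is proved by counting sign
    changes around the cells of a grid ([grid_crossing]). If a component is to
    be shown bounded, it is enough that it does not touch the circle off the
    real axis ([enclosed_bounded_component]). For a mirror-symmetric component,
    touching the upper arc means touching the lower one. For a component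
    containing the third path, touching the upper arc would lead, through the
    region below the third path, from one arc to the other without meeting
    [ga] ([no_escape]). *)

Set Implicit Arguments.
Unset Strict Implicit.
Unset Printing Implicit Defensive.

Import Order.TTheory GRing.Theory Num.Theory.
Import numFieldNormedType.Exports.

Local Open Scope classical_set_scope.
Local Open Scope ring_scope.

Local Notation Re := complex.Re.
Local Notation Im := complex.Im.

(** * The complex plane with real distances *)

Section Complex.
Variable R : realType.
Local Notation C := (Cplane R).
Implicit Types z w : C.

Definition cmod z : R := ComplexField.Normc.normc z.

Lemma normcE z : `|z| = ((cmod z)%:C)%C.
Proof. by []. Qed.

Lemma cmod_sqr z : cmod z ^+ 2 = Re z ^+ 2 + Im z ^+ 2.
Proof. by case: z => a b; rewrite /cmod/= sqr_sqrtr// addr_ge0// sqr_ge0. Qed.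

Lemma cmod_ge0 z : 0 <= cmod z.
Proof. by case: z => a b; exact: sqrtr_ge0. Qed.

Lemma cmodM z w : cmod (z * w) = cmod z * cmod w.
Proof. exact: ComplexField.Normc.normcM. Qed.

Lemma cmodV z : cmod z^-1 = (cmod z)^-1.
Proof. exact: ComplexField.Normc.normcV. Qed.

Lemma cmod0 : cmod 0 = 0.
Proof. exact: ComplexField.Normc.normc0. Qed.

Lemma cmod1 : cmod 1 = 1.
Proof. exact: ComplexField.Normc.normc1. Qed.

Lemma cmodX z n : cmod (z ^+ n) = cmod z ^+ n.
Proof. by elim: n => [|n IH]; rewrite ?expr0 ?cmod1// !exprS cmodM IH. Qed.

Lemma cmod_eq0 z : (cmod z == 0) = (z == 0).
Proof.
by apply/eqP/eqP => [/ComplexField.Normc.eq0_normc//|->]; exact: cmod0.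
Qed.

Lemma cmod_gt0 z : (0 < cmod z) = (z != 0).
Proof. by rewrite lt_neqAle cmod_ge0 andbT eq_sym cmod_eq0. Qed.

Lemma cmodN z : cmod (- z) = cmod z.
Proof. by case: z => a b; rewrite /cmod/= !sqrrN. Qed.

Lemma cmodBC z w : cmod (z - w) = cmod (w - z).
Proof. by rewrite -cmodN opprB. Qed.

Lemma cmodD z w : cmod (z + w) <= cmod z + cmod w.
Proof. by have := ler_normD z w; rewrite !normcE -rmorphD lecR. Qed.

Lemma cmodB z w : cmod (z - w) <= cmod z + cmod w.
Proof. by rewrite -(cmodN w) cmodD. Qed.

Lemma cmod_dist_trans u z w : cmod (z - w) <= cmod (z - u) + cmod (u - w).
Proof. by apply: le_trans (cmodD _ _); rewrite addrA subrK. Qed.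

Lemma normr_Re z : `|Re z| <= cmod z.
Proof.
rewrite -(@ler_pXn2r _ 2)// ?nnegrE ?cmod_ge0//.
by rewrite real_normK ?num_real// cmod_sqr lerDl sqr_ge0.
Qed.

Lemma normr_Im z : `|Im z| <= cmod z.
Proof.
rewrite -(@ler_pXn2r _ 2)// ?nnegrE ?cmod_ge0//.
by rewrite real_normK ?num_real// cmod_sqr lerDr sqr_ge0.
Qed.

Lemma cmod_le z : cmod z <= `|Re z| + `|Im z|.
Proof.
rewrite -(@ler_pXn2r _ 2)// ?nnegrE ?cmod_ge0// ?addr_ge0//.
rewrite cmod_sqr -(real_normK (num_real (Re z))) -(real_normK (num_real (Im z))).
have := normr_ge0 (Re z); have := normr_ge0 (Im z); nra.
Qed.

Lemma cmod_conj z : cmod (z^*)%C = cmod z.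
Proof. by case: z => a b; rewrite /cmod/= sqrrN. Qed.

Lemma cmodR (x : R) : cmod (x%:C)%C = `|x|.
Proof. by rewrite /cmod/= expr0n/= addr0 sqrtr_sqr. Qed.

Lemma ReD z w : Re (z + w) = Re z + Re w.
Proof. by case: z w => a b [c d]. Qed.
Lemma ImD z w : Im (z + w) = Im z + Im w.
Proof. by case: z w => a b [c d]. Qed.
Lemma ReN z : Re (- z) = - Re z. Proof. by case: z. Qed.
Lemma ImN z : Im (- z) = - Im z. Proof. by case: z. Qed.
Lemma ReB z w : Re (z - w) = Re z - Re w.
Proof. by rewrite ReD ReN. Qed.
Lemma ImB z w : Im (z - w) = Im z - Im w.
Proof. by rewrite ImD ImN. Qed.
Lemma ReM z w : Re (z * w) = Re z * Re w - Im z * Im w.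
Proof. by case: z w => a b [c d]. Qed.
Lemma ImM z w : Im (z * w) = Re z * Im w + Im z * Re w.
Proof. by case: z w => a b [c d]. Qed.

Lemma diskE z : disk z <-> cmod z < 1.
Proof. by rewrite /disk/= normcE (ltcR (cmod z) 1). Qed.

(** The norm of the complex plane takes its values in [R[i]]. Below, distances
    are the real numbers [cmod (w - z)], so that real arithmetic applies. *)
Lemma nbhs_cmodP z (A : set C) :
  nbhs z A <-> exists2 e : R, 0 < e & forall w, cmod (w - z) < e -> A w.
Proof.
split=> [/nbhs_ballP[e /= e0 H]|[e e0 H]].
  have [eI eR] : Im e = 0 /\ 0 < Re e.
    by move: e0; rewrite ltcE => /andP[/eqP ? ?].
  exists (Re e) => // w we; apply: H.
  rewrite -ball_normE/= distrC normcE.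
  by case: e {e0} eI eR we => a b /= -> _; rewrite ltcR.
apply/nbhs_ballP; exists (e%:C)%C; first by rewrite /= ltcR.
by move=> w; rewrite -ball_normE/= distrC normcE ltcR; exact: H.
Qed.

Lemma cvg_cmodP (T : Type) (F : set_system T) (FF : Filter F) (f : T -> C) (l : C) :
  f @ F --> l <-> forall e : R, 0 < e -> \forall x \near F, cmod (f x - l) < e.
Proof.
split=> [H e e0|H A /nbhs_cmodP[e e0 eA]].
  by apply: (H [set w | cmod (w - l) < e]); apply/nbhs_cmodP; exists e.
by apply: filterS (H _ e0) => x; exact: eA.
Qed.

Lemma continuous_Re : continuous (@Re R : C -> R).
Proof.
move=> z; apply/(@cvgrPdist_lt _ _ _ (nbhs z)) => e e0.
apply/nbhs_cmodP; exists e => // w; rewrite cmodBC => h.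
by rewrite -ReB; exact: le_lt_trans (normr_Re _) h.
Qed.

Lemma continuous_Im : continuous (@Im R : C -> R).
Proof.
move=> z; apply/(@cvgrPdist_lt _ _ _ (nbhs z)) => e e0.
apply/nbhs_cmodP; exists e => // w; rewrite cmodBC => h.
by rewrite -ImB; exact: le_lt_trans (normr_Im _) h.
Qed.

Lemma continuous_cmod : continuous cmod.
Proof.
move=> z; apply/(@cvgrPdist_lt _ _ _ (nbhs z)) => e e0.
apply/nbhs_cmodP; exists e => // w; apply: le_lt_trans.
rewrite ler_norml; have := cmod_dist_trans 0 z w.
have := cmod_dist_trans w z 0; have := cmod_dist_trans z w 0.
rewrite !subr0 (cmodBC z w); lra.
Qed.

Lemma continuous_Complex (T : topologicalType) (u v : T -> R) (t : T) :
  {for t, continuous u} -> {for t, continuous v} ->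
  {for t, continuous (fun x => (u x +i* v x)%C : C)}.
Proof.
move=> cu cv; apply/cvg_cmodP => e e0.
have e2 : 0 < e / 2 by rewrite divr_gt0.
move/cvgrPdist_lt: cu => /(_ _ e2) cu; move/cvgrPdist_lt: cv => /(_ _ e2) cv.
near=> x.
apply: le_lt_trans (cmod_le _) _; rewrite ReB ImB/= (splitr e).
apply: ltrD; rewrite distrC.
  by near: x.
by near: x.
Unshelve. all: by end_near. Qed.

Lemma derivable_affine_approx (f : C -> C) z : derivable f z 1 -> exists d : C,
  forall e : R, 0 < e -> exists2 r, 0 < r & forall w, cmod (w - z) < r ->
    cmod (f w - f z - d * (w - z)) <= e * cmod (w - z).
Proof.
move=> /cvg_ex[d /cvg_cmodP H]; exists d => e e0.
have [r r0 Hr] := (nbhs_cmodP _ _).1 (H e e0).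
exists r => // w wr; have [->|wz] := eqVneq w z.
  by rewrite !subrr mulr0 subr0 cmod0 mulr0.
have wz0 : w - z != 0 by rewrite subr_eq0.
have := Hr (w - z); rewrite subr0 => /(_ wr wz0) /ltW.
rewrite /= [_ *: (1 : C)]mulr1 subrK => h.
have -> : f w - f z - d * (w - z) =
    ((w - z)^-1 *: (f w - f z) - d) * (w - z).
  by rewrite mulrBl [_ *: _]mulrC mulfVK.
by rewrite cmodM ler_wpM2r// cmod_ge0.
Qed.

Lemma affine_approx_derivable (f : C -> C) z d :
  (forall e : R, 0 < e -> exists2 r, 0 < r & forall w, cmod (w - z) < r ->
    cmod (f w - f z - d * (w - z)) <= e * cmod (w - z)) ->
  derivable f z 1.
Proof.
move=> H; apply/cvg_ex; exists d; apply/cvg_cmodP => e e0.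
have e2 : 0 < e / 2 by rewrite divr_gt0.
have [r r0 Hr] := H _ e2.
apply/nbhs_cmodP; exists r => // h; rewrite subr0 => hr h0.
have := Hr (h + z); rewrite addrK => /(_ hr).
rewrite /= [_ *: (1 : C)]mulr1.
have hp : 0 < cmod h by rewrite cmod_gt0.
have -> : f (h + z) - f z - d * h = (h^-1 *: (f (h + z) - f z) - d) * h.
  by rewrite mulrBl [_ *: _]mulrC mulfVK.
rewrite cmodM ler_pM2r// => /le_lt_trans; apply.
by rewrite ltr_pdivrMr// ltr_pMr// ltrDl.
Qed.

Lemma derivable_continuousC (f : C -> C) z :
  derivable f z 1 -> {for z, continuous f}.
Proof. by move/derivable1_diffP/differentiable_continuous. Qed.

Lemma compact_rect (a b c d : R) :
  compact [set z : C | (a <= Re z <= b) /\ (c <= Im z <= d)].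
Proof.
pose h (p : R * R) : C := (p.1 +i* p.2)%C.
have -> : [set z : C | (a <= Re z <= b) /\ (c <= Im z <= d)] =
    h @` (`[a, b]%classic `*` `[c, d]%classic).
  apply/seteqP; split=> [z [h1 h2]|_ [[x y] [/= hx hy] <-]].
    by exists (Re z, Im z); [split; rewrite /= in_itv|case: z {h1 h2}].
  by move: hx hy; rewrite !in_itv.
apply: continuous_compact; last first.
  by apply: compact_setX; exact: segment_compact.
apply: continuous_subspaceT => p.
apply: continuous_Complex; [exact: cvg_fst | exact: cvg_snd].
Qed.

Lemma compact_bounded_closed (A : set C) (M : R) : closed A ->
  (forall z, A z -> cmod z <= M) -> compact A.
Proof.
move=> cA bA; apply: subclosed_compact cA (@compact_rect (- M) M (- M) M) _.
move=> z /bA h /=; rewrite -!ler_norml; split.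
  exact: le_trans (normr_Re _) h.
exact: le_trans (normr_Im _) h.
Qed.

End Complex.

(** * Goursat's theorem *)

Section Bisection.
Variable R : realType.
Implicit Types t : R * R * R * R.

Let lft t : R := t.1.1.1.
Let rgt t : R := t.1.1.2.
Let bot t : R := t.1.2.
Let top t : R := t.2.

Lemma exists_expn_half_lt (s r : R) : 0 < r -> exists n, s / 2 ^+ n < r.
Proof.
move=> r0; have [n] : exists n : nat, s / r < n%:R.
  by exists (Num.bound `|s / r|); rewrite (le_lt_trans (ler_norm _))// archi_boundP.
move=> sn; exists n; rewrite ltr_pdivrMr ?exprn_gt0//.
have n2 : (n%:R : R) < 2 ^+ n by rewrite -natrX ltr_nat ltn_expl.
by rewrite mulrC -ltr_pdivrMr// (lt_trans sn).
Qed.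

(** Goursat's bisection: a badness that always passes to one of the four
    quarters of a rectangle concentrates at a point. The point is obtained
    from suprema of the left and bottom sides of the nested rectangles. *)
Lemma bisection (bad : R -> R -> R -> R -> Prop) (a b c d : R) :
    a <= b -> c <= d -> bad a b c d ->
    (forall a' b' c' d', a' <= b' -> c' <= d' -> a <= a' -> b' <= b ->
      c <= c' -> d' <= d -> bad a' b' c' d' ->
      let m := (a' + b') / 2 in let n := (c' + d') / 2 in
      [\/ bad a' m c' n, bad m b' c' n, bad a' m n d' | bad m b' n d']) ->
  exists x y : R, [/\ a <= x <= b, c <= y <= d &
    forall r, 0 < r -> exists a' b' c' d',
      [/\ a <= a' <= x /\ x <= b' <= b, c <= c' <= y /\ y <= d' <= d,
          bad a' b' c' d' & (b' - a') + (d' - c') < r]].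
Proof.
move=> ab cd badR H.
pose good t := [/\ lft t <= rgt t, bot t <= top t, a <= lft t /\ rgt t <= b,
  c <= bot t /\ top t <= d & bad (lft t) (rgt t) (bot t) (top t)].
pose half t t' := [/\ lft t <= lft t' /\ rgt t' <= rgt t,
  bot t <= bot t' /\ top t' <= top t & (rgt t' - lft t') + (top t' - bot t') =
  ((rgt t - lft t) + (top t - bot t)) / 2].
have step t : exists t', good t -> good t' /\ half t t'.
  have [gt|?] := pselect (good t); last by exists t.
  case: (gt) => h1 h2 [h3 h4] [h5 h6] h7.
  have := H _ _ _ _ h1 h2 h3 h4 h5 h6 h7.
  set m := (lft t + rgt t) / 2; set n := (bot t + top t) / 2 => /=.
  have X l r : l = lft t /\ r = m \/ l = m /\ r = rgt t ->
      [/\ l <= r, lft t <= l, r <= rgt t & r - l = (rgt t - lft t) / 2].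
    by clear -h1; case=> -[-> ->]; split; rewrite /m; lra.
  have Y l r : l = bot t /\ r = n \/ l = n /\ r = top t ->
      [/\ l <= r, bot t <= l, r <= top t & r - l = (top t - bot t) / 2].
    by clear -h2; case=> -[-> ->]; split; rewrite /n; lra.
  have ok l r u v : l = lft t /\ r = m \/ l = m /\ r = rgt t ->
      u = bot t /\ v = n \/ u = n /\ v = top t -> bad l r u v ->
      exists t', good t -> good t' /\ half t t'.
    move=> /X[q1 q2 q3 q4] /Y[q5 q6 q7 q8] bd; exists (l, r, u, v) => _; split.
      split => //; split.
      - exact: le_trans q2.
      - exact: le_trans q3 _.
      - exact: le_trans q6.
      - exact: le_trans q7 _.
    by split => //; rewrite /lft /rgt /bot /top /= in q4 q8 *; rewrite q4 q8 -mulrDl.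
  by case; apply: ok; by [left|right].
have [next Hnext] := choice step.
pose T n := iter n next (a, b, c, d).
have gT n : good (T n).
  elim: n => [|n IH]; first by split.
  by rewrite /T iterS -/(T n); have [] := Hnext _ IH.
have hT n : half (T n) (T n.+1) by rewrite /T iterS -/(T n); have [] := Hnext _ (gT n).
have mono n k : lft (T n) <= lft (T (n + k)%N) /\ rgt (T (n + k)%N) <= rgt (T n) /\
    bot (T n) <= bot (T (n + k)%N) /\ top (T (n + k)%N) <= top (T n).
  elim: k => [|k [IH1 [IH2 [IH3 IH4]]]]; first by rewrite addn0.
  rewrite addnS; have [[h1 h2] [h3 h4] _] := hT (n + k)%N; lra.
have cross n k : lft (T n) <= rgt (T k) /\ bot (T n) <= top (T k).
  have [h1 [_ [h2 _]]] := mono n k; have [_ [h3 [_ h4]]] := mono k n.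
  rewrite addnC in h3 h4; have [h5 h6 _ _ _] := gT (n + k)%N; lra.
have szT n : (rgt (T n) - lft (T n)) + (top (T n) - bot (T n)) =
    ((b - a) + (d - c)) / 2 ^+ n.
  elim: n => [|n IH]; first by rewrite expr0 divr1.
  by have [_ _ ->] := hT n; rewrite IH exprSr invfM mulrA.
have inside (p q : R * R * R * R -> R) :
    (forall n k, p (T n) <= q (T k)) -> exists x, forall n, p (T n) <= x <= q (T n).
  move=> pq; exists (sup [set p (T n) | n in setT]) => n; apply/andP; split.
    by apply: ub_le_sup; [exists (q (T 0%N)) => _ [k _ <-] | exists n].
  by apply: ge_sup; [exists (p (T 0%N)), 0%N | move=> _ [k _ <-]].
have [x Hx] := inside lft rgt (fun n k => (cross n k).1).
have [y Hy] := inside bot top (fun n k => (cross n k).2).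
exists x, y; split; [exact: (Hx 0%N)|exact: (Hy 0%N)|].
move=> r r0; have [n Hn] := exists_expn_half_lt ((b - a) + (d - c)) r0.
exists (lft (T n)), (rgt (T n)), (bot (T n)), (top (T n)).
have [h1 h2 [h3 h4] [h5 h6] h7] := gT n.
have /andP[h8 h9] := Hx n; have /andP[h10 h11] := Hy n.
by split => //; [split; apply/andP | split; apply/andP | rewrite szT].
Qed.

End Bisection.

Section Goursat.
Variable R : realType.
Local Notation C := (Cplane R).
Local Notation mu := (@lebesgue_measure R).
Implicit Types (f g : C -> C) (u v : R -> R).

Definition integrable_seg (a b : R) u := mu.-integrable `[a, b] (EFin \o u).
Definition int_seg (a b : R) u : R := \int[mu]_(x in `[a, b]) u x.

Lemma continuous_integrable_seg a b u :
  (forall x, a <= x <= b -> {for x, continuous u}) -> integrable_seg a b u.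
Proof.
move=> cu; apply: continuous_compact_integrable; first exact: segment_compact.
apply: continuous_in_subspaceT => x; rewrite inE/= in_itv/=; exact: cu.
Qed.

Lemma int_seg_split a m b u : a <= m <= b -> integrable_seg a b u ->
  int_seg a b u = int_seg a m u + int_seg m b u.
Proof.
move=> /andP[am mb] iu; have := @Rintegral_itvB R u (BLeft a) (BRight b) m iu.
rewrite !bnd_simp => /(_ am mb) h.
rewrite /int_seg -(@Rintegral_itv_obnd_cbnd R m (BRight b) u); last first.
  apply: integrableS iu => // x; rewrite /= !in_itv/= => /andP[mx ->].
  by rewrite andbT (le_trans am)// ltW.
by rewrite -h addrC subrK.
Qed.

Lemma int_seg_le a b u v : integrable_seg a b u -> integrable_seg a b v ->
  (forall x, a <= x <= b -> u x <= v x) -> int_seg a b u <= int_seg a b v.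
Proof.
by move=> iu iv uv; apply: le_Rintegral => // x; rewrite /= in_itv; exact: uv.
Qed.

Lemma int_seg_cst a b k : a <= b -> int_seg a b (fun=> k) = k * (b - a).
Proof.
move=> ab; rewrite /int_seg Rintegral_cst//= lebesgue_measure_itv/= lte_fin.
by move: ab; rewrite le_eqVlt => /predU1P[->|->]; rewrite ?ltxx ?subrr.
Qed.

Lemma integrable_seg_cst a b k : integrable_seg a b (fun=> k).
Proof. by apply: continuous_integrable_seg => x _; exact: cvg_cst. Qed.

Lemma int_seg_norm a b u M : a <= b -> integrable_seg a b u ->
  (forall x, a <= x <= b -> `|u x| <= M) -> `|int_seg a b u| <= M * (b - a).
Proof.
move=> ab iu uM; rewrite ler_norml -mulNr -!int_seg_cst//.
by apply/andP; split; apply: int_seg_le => //; try exact: integrable_seg_cst;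
  move=> x /uM; rewrite ler_norml => /andP[].
Qed.

Lemma integrable_segB a b u v : integrable_seg a b u -> integrable_seg a b v ->
  integrable_seg a b (fun x => u x - v x).
Proof.
move=> iu iv; rewrite /integrable_seg.
have -> : EFin \o (fun x => u x - v x) = ((EFin \o u) \- (EFin \o v))%E.
  by apply/funext => x; rewrite /= EFinB.
exact: integrableB.
Qed.

Lemma int_segB a b u v : integrable_seg a b u -> integrable_seg a b v ->
  int_seg a b (fun x => u x - v x) = int_seg a b u - int_seg a b v.
Proof. by move=> iu iv; apply: RintegralB. Qed.

Lemma eq_int_seg a b u v : (forall x, a <= x <= b -> u x = v x) -> int_seg a b u = int_seg a b v.
Proof. by move=> uv; apply: eq_Rintegral => x; rewrite inE/= in_itv; exact: uv. Qed.

(** Continuity in the plane at each point of a horizontal or vertical segment. *)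
Definition continuous_hseg f a b y := forall x, a <= x <= b ->
  {for (x +i* y)%C, continuous f}.
Definition continuous_vseg f x c d := forall y, c <= y <= d ->
  {for (x +i* y)%C, continuous f}.

Lemma continuous_hseg_integrable f a b y : continuous_hseg f a b y ->
  integrable_seg a b (fun x => Im (f (x +i* y)%C)).
Proof.
move=> cf; apply: continuous_integrable_seg => x xab.
have ch : {for x, continuous (fun x => (x +i* y)%C : C)}.
  by apply: continuous_Complex; [exact: cvg_id|exact: cvg_cst].
have cfh := continuous_comp ch (cf _ xab).
exact: (@continuous_comp R C R _ _ _ cfh (@continuous_Im R _)).
Qed.

Lemma continuous_vseg_integrable f x c d : continuous_vseg f x c d ->
  integrable_seg c d (fun y => Re (f (x +i* y)%C)).
Proof.
move=> cf; apply: continuous_integrable_seg => y ycd.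
have ch : {for y, continuous (fun y => (x +i* y)%C : C)}.
  by apply: continuous_Complex; [exact: cvg_cst|exact: cvg_id].
have cfh := continuous_comp ch (cf _ ycd).
exact: (@continuous_comp R C R _ _ _ cfh (@continuous_Re R _)).
Qed.

(** The imaginary part of the contour integral of [f dz] around the rectangle
    with opposite sides already paired. The imaginary part alone suffices below,
    and in paired form the integral of an affine function is visibly zero:
    only constants are integrated. *)
Definition Im_contour f a b c d : R :=
  int_seg a b (fun x => Im (f (x +i* c)%C) - Im (f (x +i* d)%C)) +
  int_seg c d (fun y => Re (f (b +i* y)%C) - Re (f (a +i* y)%C)).

Lemma Im_contour_splitx f a m b c d : a <= m <= b ->
  continuous_hseg f a b c -> continuous_hseg f a b d ->
  continuous_vseg f a c d -> continuous_vseg f m c d -> continuous_vseg f b c d ->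
  Im_contour f a b c d = Im_contour f a m c d + Im_contour f m b c d.
Proof.
move=> amb hc hd va vm vb.
have ia := continuous_vseg_integrable va; have im := continuous_vseg_integrable vm; have ib := continuous_vseg_integrable vb.
rewrite /Im_contour (int_seg_split amb); last by apply: integrable_segB; exact: continuous_hseg_integrable.
rewrite (int_segB ib ia) (int_segB im ia) (int_segB ib im); lra.
Qed.

Lemma Im_contour_splity f a b c m d : c <= m <= d ->
  continuous_vseg f a c d -> continuous_vseg f b c d ->
  continuous_hseg f a b c -> continuous_hseg f a b m -> continuous_hseg f a b d ->
  Im_contour f a b c d = Im_contour f a b c m + Im_contour f a b m d.
Proof.
move=> cmd va vb hc hm hd.
have ic := continuous_hseg_integrable hc; have im := continuous_hseg_integrable hm; have id := continuous_hseg_integrable hd.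
rewrite /Im_contour (@int_seg_split c m d)//; last by apply: integrable_segB; exact: continuous_vseg_integrable.
rewrite (int_segB ic id) (int_segB ic im) (int_segB im id); lra.
Qed.

Lemma Im_contour_bound f a b c d M : a <= b -> c <= d ->
  continuous_hseg f a b c -> continuous_hseg f a b d -> continuous_vseg f a c d -> continuous_vseg f b c d ->
  (forall x y, a <= x <= b -> c <= y <= d ->
     [\/ x = a, x = b, y = c | y = d] -> cmod (f (x +i* y)%C) <= M) ->
  `|Im_contour f a b c d| <= 2 * M * ((b - a) + (d - c)).
Proof.
move=> ab cd hc hd va vb fM.
have := continuous_hseg_integrable hc; have := continuous_hseg_integrable hd.
have := continuous_vseg_integrable va; have := continuous_vseg_integrable vb => iv1 iv2 ih1 ih2.
rewrite /Im_contour mulrDr; apply: le_trans (ler_normD _ _) _; apply: lerD.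
  apply: int_seg_norm => //; first exact: integrable_segB.
  move=> x xab; rewrite mulr2n mulrDl !mul1r; apply: le_trans (ler_normB _ _) _.
  by apply: lerD; apply: le_trans (normr_Im _) _; apply: fM => //;
    rewrite ?cd ?lexx//; [constructor 3|constructor 4].
apply: int_seg_norm => //; first exact: integrable_segB.
move=> y ycd; rewrite mulr2n mulrDl !mul1r; apply: le_trans (ler_normB _ _) _.
by apply: lerD; apply: le_trans (normr_Re _) _; apply: fM => //;
  rewrite ?ab ?lexx//; [constructor 2|constructor 1].
Qed.

Lemma continuous_sub_affine f (k k0 z1 w : C) : {for w, continuous f} ->
  {for w, continuous (fun w => f w - k0 - k * (w - z1))}.
Proof.
move=> cw; have cc (a : C) : {for w, continuous (fun _ : C => a)}.
  exact: cst_continuous.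
have ci : {for w, continuous (fun x : C => x)} by exact: cvg_id.
exact: (continuousB (continuousB cw (cc k0))
  (continuousM (cc k) (continuousB ci (cc z1)))).
Qed.

Lemma Im_contour_sub_affine f a b c d (k z1 k0 : C) : a <= b -> c <= d ->
  continuous_hseg f a b c -> continuous_hseg f a b d -> continuous_vseg f a c d -> continuous_vseg f b c d ->
  Im_contour (fun w => f w - k0 - k * (w - z1)) a b c d = Im_contour f a b c d.
Proof.
move=> ab cd hc hd va vb.
have := continuous_hseg_integrable hc; have := continuous_hseg_integrable hd.
have := continuous_vseg_integrable va; have := continuous_vseg_integrable vb => iv1 iv2 ih1 ih2.
rewrite /Im_contour.
rewrite (@eq_int_seg a b _ (fun x => (Im (f (x +i* c)%C) - Im (f (x +i* d)%C)) -
   (Re k * (c - d)))); last first.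
  by move=> x _; case: z1 k k0 => [? ?] [? ?] [? ?]; rewrite !(ImB,ImM)/=; lra.
rewrite (@eq_int_seg c d _ (fun y => (Re (f (b +i* y)%C) - Re (f (a +i* y)%C)) -
   (Re k * (b - a)))); last first.
  by move=> x _; case: z1 k k0 => [? ?] [? ?] [? ?]; rewrite !(ReB,ReM)/=; lra.
rewrite !(@int_segB _ _ _ (fun=> _)) ?int_seg_cst//; try exact: integrable_seg_cst; try exact: integrable_segB.
lra.
Qed.

Lemma dist_in_seg (a b x y : R) : a <= x <= b -> a <= y <= b -> `|x - y| <= b - a.
Proof. by rewrite ler_norml; lra. Qed.

Definition rect (a b c d : R) : set C :=
  [set z | a <= Re z <= b /\ c <= Im z <= d].

Lemma rect_edges f a b c d a' b' c' d' :
  (forall z, rect a b c d z -> {for z, continuous f}) ->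
  a <= a' -> b' <= b -> c <= c' -> d' <= d ->
  (forall y, c' <= y <= d' -> continuous_hseg f a' b' y) /\
  (forall x, a' <= x <= b' -> continuous_vseg f x c' d').
Proof.
by move=> cf h1 h2 h3 h4; split=> [y /andP[? ?] x /andP[? ?]|x /andP[? ?] y /andP[? ?]];
  apply: cf; split; apply/andP; split=> /=; lra.
Qed.

Lemma Im_contour_quarters f a m b c n d : a <= m <= b -> c <= n <= d ->
  (forall y, c <= y <= d -> continuous_hseg f a b y) ->
  (forall x, a <= x <= b -> continuous_vseg f x c d) ->
  Im_contour f a b c d = Im_contour f a m c n + Im_contour f m b c n + Im_contour f a m n d + Im_contour f m b n d.
Proof.
move=> /andP[am mb] /andP[cn nd] eh ev.
have cd := le_trans cn nd; have ab := le_trans am mb.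
have hl y : c <= y <= d -> continuous_hseg f a m y.
  by move=> /eh h x /andP[ax xm]; apply: h; rewrite ax (le_trans xm).
have hr y : c <= y <= d -> continuous_hseg f m b y.
  by move=> /eh h x /andP[mx xb]; apply: h; rewrite xb (le_trans am).
have -> : Im_contour f a b c d = Im_contour f a m c d + Im_contour f m b c d.
  by apply: Im_contour_splitx; do ?[apply: eh|apply: ev]; rewrite ?lexx ?am ?mb ?ab ?cd.
have -> : Im_contour f a m c d = Im_contour f a m c n + Im_contour f a m n d.
  by apply: Im_contour_splity; do ?[apply: hl|apply: ev];
    rewrite ?lexx ?am ?mb ?ab ?cn ?nd ?cd.
have -> : Im_contour f m b c d = Im_contour f m b c n + Im_contour f m b n d.
  by apply: Im_contour_splity; do ?[apply: hr|apply: ev];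
    rewrite ?lexx ?am ?mb ?ab ?cn ?nd ?cd.
by rewrite addrACA !addrA.
Qed.

(** If the contour integral were nonzero, bisection would produce arbitrarily
    small rectangles around a point on which it is at least a fixed multiple
    [e] of the square of the semi-perimeter. Subtracting the affine
    approximation of [f] at that point does not change the integral and makes
    it smaller than that. *)
Lemma Goursat f a b c d : a <= b -> c <= d ->
  (forall z, rect a b c d z -> derivable f z 1) -> Im_contour f a b c d = 0.
Proof.
move=> ab cd df.
have cf z : rect a b c d z -> {for z, continuous f}.
  by move=> /df; exact: derivable_continuousC.
apply: contrapT => /eqP J0.
set s := (b - a) + (d - c).
have s0 : 0 <= s by rewrite /s; lra.
have n0 : 0 < `|Im_contour f a b c d| by rewrite normr_gt0.
pose e := `|Im_contour f a b c d| / (s ^+ 2 + 1).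
have s1 : 0 < s ^+ 2 + 1 by rewrite ltr_wpDl// sqr_ge0.
have e0 : 0 < e by rewrite divr_gt0.
pose bad a' b' c' d' : Prop :=
  e * ((b' - a') + (d' - c')) ^+ 2 < `|Im_contour f a' b' c' d'|.
have badR : bad a b c d.
  rewrite /bad -/s /e mulrAC ltr_pdivrMr// mulrDr mulr1; lra.
have [|x [y [xab ycd Hxy]]] := @bisection R bad _ _ _ _ ab cd badR.
  move=> a' b' c' d' ab' cd' h1 h2 h3 h4 bd m n.
  have [eh ev] := rect_edges cf h1 h2 h3 h4.
  have amb : a' <= m <= b' by rewrite /m; lra.
  have cnd : c' <= n <= d' by rewrite /n; lra.
  apply: contrapT => nbad.
  have small a0 b0 c0 d0 : ~ bad a0 b0 c0 d0 ->
      `|Im_contour f a0 b0 c0 d0| <= e * ((b0 - a0) + (d0 - c0)) ^+ 2.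
    by rewrite /bad leNgt => /negP.
  have q1 : ~ bad a' m c' n by move=> ?; apply: nbad; constructor 1.
  have q2 : ~ bad m b' c' n by move=> ?; apply: nbad; constructor 2.
  have q3 : ~ bad a' m n d' by move=> ?; apply: nbad; constructor 3.
  have q4 : ~ bad m b' n d' by move=> ?; apply: nbad; constructor 4.
  move: q1 q2 q3 q4 => /small q1 /small q2 /small q3 /small q4.
  move: bd; rewrite /bad (Im_contour_quarters amb cnd eh ev); apply/negP; rewrite -leNgt.
  have tri (p q r w : R) : `|p + q + r + w| <= `|p| + `|q| + `|r| + `|w|.
    apply: le_trans (ler_normD _ _) _; rewrite lerD2r.
    by apply: le_trans (ler_normD _ _) _; rewrite lerD2r ler_normD.
  apply: le_trans (tri _ _ _ _) _.
  apply: le_trans (lerD (lerD (lerD q1 q2) q3) q4) _.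
  by rewrite /m /n le_eqVlt; apply/orP; left; apply/eqP; field.
have [k Hk] := derivable_affine_approx (df (x +i* y)%C (conj xab ycd)).
have e2 : 0 < e / 2 by rewrite divr_gt0.
have [r r0 Hr] := Hk _ e2.
have [a' [b' [c' [d' [[/andP[h1 h2] /andP[h3 h4]] [/andP[h5 h6] /andP[h7 h8]]]]]]]
   := Hxy _ r0.
rewrite /bad; set t := _ + _ => + tr; apply/negP; rewrite -leNgt.
have [eh ev] := rect_edges cf h1 h4 h5 h8.
have ab' := le_trans h2 h3; have cd' := le_trans h6 h7.
set z : C := (x +i* y)%C in Hr.
rewrite -(@Im_contour_sub_affine f a' b' c' d' k z (f z)) //; last 4 first.
  by apply: eh; rewrite lexx.
  by apply: eh; rewrite lexx cd'.
  by apply: ev; rewrite lexx.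
  by apply: ev; rewrite lexx ab'.
have cl w := @continuous_sub_affine f k (f z) z w.
have -> : e * t ^+ 2 = 2 * (e / 2 * t) * t by field.
apply: (Im_contour_bound ab' cd').
- by move=> ? ?; apply/cl/eh => //; rewrite lexx.
- by move=> ? ?; apply/cl/eh => //; rewrite lexx cd'.
- by move=> ? ?; apply/cl/ev => //; rewrite lexx.
- by move=> ? ?; apply/cl/ev => //; rewrite lexx ab'.
move=> x' y' xb' yb' _.
have wz : cmod ((x' +i* y')%C - z) <= t.
  apply: le_trans (cmod_le _) _; rewrite ReB ImB /= /t.
  by apply: lerD; apply: dist_in_seg => //; apply/andP.
apply: le_trans (Hr _ _) _; first exact: le_lt_trans wz tr.
by rewrite ler_pM2l.
Qed.

Lemma continuous_hseg_sub f a b a' b' y : a <= a' -> b' <= b -> continuous_hseg f a b y ->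
  continuous_hseg f a' b' y.
Proof.
move=> aa bb cf x /andP[ax xb].
by apply: cf; rewrite (le_trans aa ax) (le_trans xb bb).
Qed.

Lemma continuous_vseg_sub f x c d c' d' : c <= c' -> d' <= d -> continuous_vseg f x c d ->
  continuous_vseg f x c' d'.
Proof.
move=> cc dd cf y /andP[cy yd].
by apply: cf; rewrite (le_trans cc cy) (le_trans yd dd).
Qed.

(** The frame between the two rectangles is cut into four rectangles. *)
Lemma Im_contour_frame f x0 x1 x2 x3 y0 y1 y2 y3 :
  x0 <= x1 -> x1 <= x2 -> x2 <= x3 -> y0 <= y1 -> y1 <= y2 -> y2 <= y3 ->
  (forall z, rect x0 x3 y0 y3 z ->
     [\/ Re z <= x1, x2 <= Re z, Im z <= y1 | y2 <= Im z] -> derivable f z 1) ->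
  Im_contour f x0 x3 y0 y3 = Im_contour f x1 x2 y1 y2.
Proof.
move=> x01 x12 x23 y01 y12 y23 df.
have x02 := le_trans x01 x12; have x13 := le_trans x12 x23.
have y02 := le_trans y01 y12; have y13 := le_trans y12 y23.
have x03 := le_trans x01 x13; have y03 := le_trans y01 y13.
have H y : y0 <= y <= y3 -> y <= y1 \/ y2 <= y -> continuous_hseg f x0 x3 y.
  move=> yb yc x xb; apply: derivable_continuousC; apply: df; first by split.
  by case: yc; [constructor 3|constructor 4].
have V x : x0 <= x <= x3 -> x <= x1 \/ x2 <= x -> continuous_vseg f x y0 y3.
  move=> xb xc y yb; apply: derivable_continuousC; apply: df; first by split.
  by case: xc; [constructor 1|constructor 2].
have [H0 H1 H2 H3] : [/\ continuous_hseg f x0 x3 y0, continuous_hseg f x0 x3 y1, continuous_hseg f x0 x3 y2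
    & continuous_hseg f x0 x3 y3].
  split; apply: H; rewrite ?lexx ?y01 ?y02 ?y03 ?y13 ?y23//;
    by [left|right|left; rewrite lexx|right; rewrite lexx].
have [V0 V1 V2 V3] : [/\ continuous_vseg f x0 y0 y3, continuous_vseg f x1 y0 y3, continuous_vseg f x2 y0 y3
    & continuous_vseg f x3 y0 y3].
  split; apply: V; rewrite ?lexx ?x01 ?x02 ?x03 ?x13 ?x23//;
    by [left|right|left; rewrite lexx|right; rewrite lexx].
have sub a b c d z : x0 <= a -> b <= x3 -> y0 <= c -> d <= y3 ->
    rect a b c d z -> rect x0 x3 y0 y3 z.
  move=> h1 h2 h3 h4 [/andP[q1 q2] /andP[q3 q4]].
  by split; rewrite (le_trans h1 q1, le_trans h3 q3) (le_trans q2 h2, le_trans q4 h4).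
have zero a b c d : a <= b -> c <= d -> x0 <= a -> b <= x3 -> y0 <= c -> d <= y3 ->
    [\/ b <= x1, x2 <= a, d <= y1 | y2 <= c] -> Im_contour f a b c d = 0.
  move=> ab cd h1 h2 h3 h4 out; apply: Goursat => // z zr.
  apply: df; first exact: sub zr.
  case: zr => /andP[q1 q2] /andP[q3 q4]; case: out => h.
  - by constructor 1; exact: le_trans q2 h.
  - by constructor 2; exact: le_trans h q1.
  - by constructor 3; exact: le_trans q4 h.
  - by constructor 4; exact: le_trans h q3.
have h12 y : continuous_hseg f x0 x3 y -> continuous_hseg f x1 x2 y by exact: continuous_hseg_sub.
have h13 y : continuous_hseg f x0 x3 y -> continuous_hseg f x1 x3 y by exact: continuous_hseg_sub.
have v13 x : continuous_vseg f x y0 y3 -> continuous_vseg f x y1 y3 by exact: continuous_vseg_sub.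
rewrite (@Im_contour_splitx f x0 x1 x3) ?x01// (zero x0 x1)//; last by constructor 1.
rewrite add0r (@Im_contour_splitx f x1 x2 x3) ?x12//; [|exact: h13|exact: h13].
rewrite (zero x2 x3)//; last by constructor 2.
rewrite addr0 (@Im_contour_splity f x1 x2 y0 y1 y3) ?y01//; [|exact: h12..].
rewrite (zero x1 x2 y0 y1)//; last by constructor 3.
rewrite add0r (@Im_contour_splity f x1 x2 y1 y2 y3) ?y12//;
  [|exact: v13|exact: v13|exact: h12..].
by rewrite (zero x1 x2 y2 y3)// ?addr0//; constructor 4.
Qed.

(** A bounded singularity at the centre does not contribute: over the boundary
    of a small central square the integral is at most a constant times the
    side. *)
Lemma Goursat_punctured f (p1 p2 r r1 M : R) : 0 < r -> 0 < r1 -> 0 <= M ->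
  (forall z, rect (p1 - r) (p1 + r) (p2 - r) (p2 + r) z -> z != (p1 +i* p2)%C ->
     derivable f z 1) ->
  (forall z, cmod (z - (p1 +i* p2)%C) < r1 -> z != (p1 +i* p2)%C ->
     cmod (f z) <= M) ->
  Im_contour f (p1 - r) (p1 + r) (p2 - r) (p2 + r) = 0.
Proof.
move=> r0 r10 M0 df fM.
have small s : 0 < s -> s <= r -> s <= r1 / 3 ->
    `|Im_contour f (p1 - r) (p1 + r) (p2 - r) (p2 + r)| <= 8 * M * s.
  move=> s0 sr sr1; have s2 := ltW s0.
  have l1 (p : R) : p - r <= p - s by rewrite lerD2l lerN2.
  have l2 (p : R) : p - s <= p + s by rewrite lerD2l (le_trans _ s2)// oppr_le0.
  have l3 (p : R) : p + s <= p + r by rewrite lerD2l.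
  have np z : [\/ Re z <= p1 - s, p1 + s <= Re z, Im z <= p2 - s | p2 + s <= Im z] ->
      z != (p1 +i* p2)%C.
    by apply: contraPneq => -> /=; rewrite !lerBrDr !gerDl !leNgt s0; case.
  have dS z : rect (p1 - r) (p1 + r) (p2 - r) (p2 + r) z ->
      [\/ Re z <= p1 - s, p1 + s <= Re z, Im z <= p2 - s | p2 + s <= Im z] ->
      derivable f z 1.
    by move=> zr /np; exact: df.
  rewrite (Im_contour_frame (l1 p1) (l2 p1) (l3 p1) (l1 p2) (l2 p2) (l3 p2) dS).
  have -> : 8 * M * s = 2 * M * (p1 + s - (p1 - s) + (p2 + s - (p2 - s))) by ring.
  have cS x y : p1 - s <= x <= p1 + s -> p2 - s <= y <= p2 + s ->
      [\/ x <= p1 - s, p1 + s <= x, y <= p2 - s | p2 + s <= y] ->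
      {for (x +i* y)%C, continuous f}.
    move=> /andP[h1 h2] /andP[h3 h4] e; apply/derivable_continuousC/dS => //.
    by split; rewrite /= (le_trans (l1 _), le_trans (l1 _)) ?(le_trans _ (l3 _)).
  apply: (Im_contour_bound (l2 p1) (l2 p2)).
  - by move=> x xb; apply: cS => //; rewrite ?lexx ?l2//; constructor 3.
  - by move=> x xb; apply: cS => //; rewrite ?lexx ?l2//; constructor 4.
  - by move=> y yb; apply: cS => //; rewrite ?lexx ?l2//; constructor 1.
  - by move=> y yb; apply: cS => //; rewrite ?lexx ?l2//; constructor 2.
  move=> x y /andP[x1 x2] /andP[y1 y2] e; apply: fM.
    apply: le_lt_trans (cmod_le _) _; rewrite ReB ImB/=.
    have xs : `|x - p1| <= s by rewrite ler_distl x1.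
    have ys : `|y - p2| <= s by rewrite ler_distl y1.
    apply: le_lt_trans (lerD xs ys) _; clear -sr1 s0; lra.
  by apply: np; case: e => ->; rewrite lexx;
    [constructor 1|constructor 2|constructor 3|constructor 4].
apply: contrapT => /eqP; rewrite -normr_gt0 => J0.
set j := `|Im_contour _ _ _ _ _| in small J0.
pose s := Num.min (Num.min r (r1 / 3)) (j / (8 * M + 1) / 2).
have M1 : 0 < 8 * M + 1 by lra.
have s0 : 0 < s by rewrite !lt_min r0 !divr_gt0.
have sr : s <= r by rewrite !ge_min lexx.
have sr1 : s <= r1 / 3 by rewrite !ge_min lexx orbT.
have := small s s0 sr sr1.
have : s <= j / (8 * M + 1) / 2 by rewrite ge_min lexx orbT.
rewrite ler_pdivlMr// ler_pdivlMr// => h1 h2.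
have : 0 <= M * s by rewrite mulr_ge0// ltW.
nra.
Qed.

End Goursat.

(** * The maximum principle *)

Section ComplexDerivability.
Variable R : realType.
Local Notation C := (Cplane R).
Implicit Types (f g : C -> C) (z : C).

Lemma derivableC_cst (a : C) z : derivable (fun _ : C => a) z 1.
Proof. exact: derivable_cst. Qed.

Lemma derivableC_id z : derivable (fun w : C => w) z 1.
Proof. exact: derivable_id. Qed.

Lemma derivableCD f g z : derivable f z 1 -> derivable g z 1 ->
  derivable (fun w => f w + g w) z 1.
Proof. exact: derivableD. Qed.

Lemma derivableCB f g z : derivable f z 1 -> derivable g z 1 ->
  derivable (fun w => f w - g w) z 1.
Proof. exact: derivableB. Qed.

Lemma derivableCM f g z : derivable f z 1 -> derivable g z 1 ->
  derivable (fun w => f w * g w) z 1.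
Proof. exact: derivableM. Qed.

Lemma derivableCX f n z : derivable f z 1 -> derivable (fun w => f w ^+ n) z 1.
Proof.
move=> df; elim: n => [|n IH].
  have -> : (fun w => f w ^+ 0) = (fun _ : C => 1) by apply/funext => w; rewrite expr0.
  exact: derivableC_cst.
have -> : (fun w => f w ^+ n.+1) = (fun w => f w * f w ^+ n).
  by apply/funext => w; rewrite exprS.
exact: derivableCM.
Qed.

Lemma derivableCV f z : f z != 0 -> derivable f z 1 ->
  derivable (fun w => (f w)^-1) z 1.
Proof. exact: derivableV. Qed.

Lemma conjcBM (a b c d : C) :
  ((a - b - c * d)^*)%C = (a^*)%C - (b^*)%C - (c^*)%C * (d^*)%C :> C.
Proof.
case: a b c d => [? ?] [? ?] [? ?] [? ?].
by apply/eqP; rewrite eq_complex/=; apply/andP; split; apply/eqP; ring.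
Qed.

(** The function is the Schwarz reflection of [f] in the real axis. *)
Lemma derivableC_conj f z : derivable f (z^*)%C 1 ->
  derivable (fun w : C => (f (w^*)%C)^*%C : C) z 1.
Proof.
move=> /derivable_affine_approx[d Hd]; apply: (@affine_approx_derivable _ _ _ (d^*)%C) => e /Hd[r r0 H].
have cB (a b : C) : cmod ((a^*)%C - (b^*)%C : C) = cmod (a - b).
  rewrite -[RHS]cmod_conj; congr cmod; case: a b => [? ?] [? ?].
  by apply/eqP; rewrite eq_complex/=; apply/andP; split; apply/eqP; ring.
exists r => // w wr; have := H (w^*)%C; rewrite cB => /(_ wr).
rewrite -[X in X <= _ -> _]cmod_conj conjcBM.
suff -> : ((((w^*)%C - (z^*)%C : C))^*)%C = w - z by [].
case: w z {H wr Hd} => [? ?] [? ?].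
by apply/eqP; rewrite eq_complex/=; apply/andP; split; apply/eqP; ring.
Qed.

End ComplexDerivability.

Section MaximumPrinciple.
Variable R : realType.
Local Notation C := (Cplane R).

Lemma exists_expn_lt (rho e : R) : 0 <= rho < 1 -> 0 < e -> exists n, rho ^+ n < e.
Proof.
move=> /andP[r0 r1] e0.
have /cvg_expr/cvgrPdist_lt/(_ _ e0)[N _ H] : `|rho| < 1 by rewrite ger0_norm.
by exists N; have := H N (leqnn _); rewrite sub0r normrN ger0_norm// exprn_ge0.
Qed.

(** The kernel [1/w] has a large normal component along the boundary of a
    square centred at the origin. *)
Lemma Re_inv_ge (x y r : R) (k : C) : 0 < r -> x = r \/ x = - r -> `|y| <= r ->
  cmod k <= 4^-1 -> (4 * r)^-1 <= (x / r) * Re ((1 - k) / (x +i* y)%C : C).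
Proof.
move=> r0 xr yr k4.
have := le_trans (normr_Re _) k4; have := le_trans (normr_Im _) k4.
case: k {k4} => u v /=; rewrite !ler_norml => /andP[v1 v2] /andP[u1 u2].
move: yr; rewrite ler_norml => /andP[y1 y2].
have N0 : 0 < x ^+ 2 + y ^+ 2 by case: xr => ->; nra.
have -> : (x / r) * ((1 - u) * (x / (x ^+ 2 + y ^+ 2)) -
    (0 - v) * - (y / (x ^+ 2 + y ^+ 2))) =
    (x / r * ((1 - u) * x - v * y)) / (x ^+ 2 + y ^+ 2).
  by field; rewrite !gt_eqF.
rewrite invfM ler_pdivlMr// mulrAC ler_pdivrMr//.
have vy : `|v * y| <= 4^-1 * r.
  by rewrite normrM; apply: ler_pM => //; rewrite ler_norml; apply/andP; split.
move: vy; rewrite ler_norml => /andP[vy1 vy2].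
by case: xr => ->; rewrite ?mulNr divff ?gt_eqF// ?mulN1r ?mul1r; nra.
Qed.

(** Multiplication by [- i] turns the horizontal sides into vertical ones. *)
Lemma Im_inv_ge (x y r : R) (k : C) : 0 < r -> y = r \/ y = - r -> `|x| <= r ->
  cmod k <= 4^-1 -> (4 * r)^-1 <= - (y / r) * Im ((1 - k) / (x +i* y)%C : C).
Proof.
move=> r0 yr xr k4.
have := @Re_inv_ge y (- x) r k r0 yr; rewrite normrN => /(_ xr k4).
have -> : Re ((1 - k) / (y -i* x)%C : C) = - Im ((1 - k) / (x +i* y)%C : C).
  by case: k {k4} => u v /=; rewrite sqrrN (addrC (y ^+ 2)); ring.
by rewrite mulrN mulNr.
Qed.

(** With [h = (k / k p)^n] for [n] large, [(1 - h z) / (z - p)] has a removable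
    singularity at [p], so its contour integral vanishes; but on the boundary
    of the square [h] is so small that the integrand stays positive there, as
    that of [1 / (z - p)] is. Unlike in Cauchy's formula, the integral of
    [1 / (z - p)] does not have to be evaluated. *)
Lemma no_strict_max_on_square (k : C -> C) (p1 p2 r rho : R) :
  let p : C := (p1 +i* p2)%C in
  0 < r -> 0 <= rho < 1 -> k p != 0 ->
  (forall z, rect (p1 - r) (p1 + r) (p2 - r) (p2 + r) z -> derivable k z 1) ->
  (forall z, rect (p1 - r) (p1 + r) (p2 - r) (p2 + r) z -> r <= cmod (z - p) ->
    cmod (k z) <= rho * cmod (k p)) -> False.
Proof.
move=> p r0 rho01 kp0 dk kb.
have [n Hn] := @exists_expn_lt rho 4^-1 rho01 (ltac:(by rewrite invr_gt0)).
have rp : rect (p1 - r) (p1 + r) (p2 - r) (p2 + r) p by split=> /=; lra.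
pose h (z : C) : C := (k z / k p) ^+ n.
have dh z : rect (p1 - r) (p1 + r) (p2 - r) (p2 + r) z -> derivable h z 1.
  move=> /dk dz; have d1 := derivableCM dz (@derivableC_cst R (k p)^-1 z).
  exact: (@derivableCX R _ n z d1).
have hb z : rect (p1 - r) (p1 + r) (p2 - r) (p2 + r) z -> r <= cmod (z - p) ->
    cmod (h z) <= 4^-1.
  move=> zr /(kb z zr) kz; apply: le_trans (ltW Hn); rewrite cmodX.
  apply: lerXn2r; rewrite ?nnegrE ?cmod_ge0//; first by case/andP: rho01.
  by rewrite cmodM cmodV ler_pdivrMr// cmod_gt0.
pose G (z : C) : C := (1 - h z) / (z - p).
have dG0 z : rect (p1 - r) (p1 + r) (p2 - r) (p2 + r) z -> z - p != 0 ->
    derivable G z 1.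
  move=> /dh dz zp; have d1 := derivableCB (@derivableC_cst R 1 z) dz.
  have d2 := derivableCB (@derivableC_id R z) (@derivableC_cst R p z).
  exact: (derivableCM d1 (derivableCV (f := fun z => z - p) zp d2)).
have hp : h p = 1 by rewrite /h divff// expr1n.
have [d Hd] := derivable_affine_approx (dh p rp).
have [r1 r10 Hr1] := Hd 1 ltr01.
have J0 : Im_contour G (p1 - r) (p1 + r) (p2 - r) (p2 + r) = 0.
  apply: (@Goursat_punctured R G p1 p2 r r1 (cmod d + 1)) => //.
  - by rewrite addr_ge0// cmod_ge0.
  - by move=> z zr zp; apply: dG0; rewrite ?subr_eq0.
  - move=> z /Hr1; rewrite -/p hp mul1r => hz zp.
    rewrite /G cmodM cmodV ler_pdivrMr ?cmod_gt0 ?subr_eq0// (cmodBC 1) mulrDl mul1r.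
    have -> : h z - 1 = d * (z - p) + (h z - 1 - d * (z - p)).
      by rewrite [RHS]addrC subrK.
    apply: le_trans (cmodD _ _) _; rewrite cmodM; exact: lerD.
have GE x y : G ((p1 + x) +i* (p2 + y))%C =
    (1 - h ((p1 + x) +i* (p2 + y))%C) / (x +i* y)%C.
  by rewrite /G; congr (_ / _); apply/eqP; rewrite eq_complex/=; apply/andP;
    split; apply/eqP; ring.
have rxy x y : `|x| <= r -> `|y| <= r -> rect (p1 - r) (p1 + r) (p2 - r) (p2 + r)
    ((p1 + x) +i* (p2 + y))%C.
  by rewrite !ler_norml => ? ?; split=> /=; lra.
have pxy x y : (((p1 + x) +i* (p2 + y))%C : C) - p = (x +i* y)%C.
  by apply/eqP; rewrite eq_complex/=; apply/andP; split; apply/eqP; ring.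
have dG x y : `|x| <= r -> `|y| <= r -> r <= `|x| \/ r <= `|y| ->
    {for ((p1 + x) +i* (p2 + y))%C, continuous G} /\
    cmod (h ((p1 + x) +i* (p2 + y))%C) <= 4^-1.
  move=> xr yr xy; have rc : r <= cmod (x +i* y)%C.
    case: xy => /le_trans; apply; [exact: (@normr_Re R (x +i* y)%C)|].
    exact: (@normr_Im R (x +i* y)%C).
  split; last by apply: hb; [exact: rxy|rewrite pxy].
  apply: derivable_continuousC; apply: dG0; first exact: rxy.
  by rewrite pxy -cmod_gt0 (lt_le_trans r0).
have nr : `|r| = r by rewrite ger0_norm// ltW.
have H (y : R) : y = r \/ y = - r -> continuous_hseg G (p1 - r) (p1 + r) (p2 + y).
  move=> yr x xr; have -> : x = p1 + (x - p1) by ring.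
  apply: (dG _ _ _ _ _).1; first by rewrite ler_norml; lra.
    by case: yr => ->; rewrite ?normrN nr.
  by right; case: yr => ->; rewrite ?normrN nr.
have V (x : R) : x = r \/ x = - r -> continuous_vseg G (p1 + x) (p2 - r) (p2 + r).
  move=> xr y yr; have -> : y = p2 + (y - p2) by ring.
  apply: (dG _ _ _ _ _).1; last by left; case: xr => ->; rewrite ?normrN nr.
    by case: xr => ->; rewrite ?normrN nr.
  by rewrite ler_norml; lra.
have e1 : (2 * r)^-1 * (2 * r) = 1 by rewrite mulVf//; lra.
have i1 : 1 <= int_seg (p1 - r) (p1 + r) (fun x =>
    Im (G (x +i* (p2 - r))%C) - Im (G (x +i* (p2 + r))%C)).
  rewrite -[leLHS]e1 [X in _ * X](_ : _ = (p1 + r) - (p1 - r)); last by ring.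
  rewrite -int_seg_cst; last by lra.
  apply: int_seg_le; first exact: integrable_seg_cst.
    by apply: integrable_segB; apply: continuous_hseg_integrable; apply: H; [right|left].
  move=> x xr; have -> : x = p1 + (x - p1) by ring.
  have xr' : `|x - p1| <= r by rewrite ler_norml; lra.
  have [_ h1] := dG (x - p1) (- r) xr' (ltac:(by rewrite normrN nr))
    (ltac:(by right; rewrite normrN nr)).
  have [_ h2] := dG (x - p1) r xr' (ltac:(by rewrite nr)) (ltac:(by right; rewrite nr)).
  have := Im_inv_ge r0 (or_intror erefl) xr' h1.
  have := Im_inv_ge r0 (or_introl erefl) xr' h2.
  rewrite -!GE mulNr divff ?gt_eqF// !mulNr divff ?gt_eqF// opprK !mul1r invfM.
  move=> q1 q2; rewrite invfM; lra.
have i2 : 1 <= int_seg (p2 - r) (p2 + r) (fun y =>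
    Re (G ((p1 + r) +i* y)%C) - Re (G ((p1 - r) +i* y)%C)).
  rewrite -[leLHS]e1 [X in _ * X](_ : _ = (p2 + r) - (p2 - r)); last by ring.
  rewrite -int_seg_cst; last by lra.
  apply: int_seg_le; first exact: integrable_seg_cst.
    by apply: integrable_segB; apply: continuous_vseg_integrable; apply: V; [left|right].
  move=> y yr; have -> : y = p2 + (y - p2) by ring.
  have yr' : `|y - p2| <= r by rewrite ler_norml; lra.
  have [_ h1] := dG (- r) (y - p2) (ltac:(by rewrite normrN nr)) yr'
    (ltac:(by left; rewrite normrN nr)).
  have [_ h2] := dG r (y - p2) (ltac:(by rewrite nr)) yr' (ltac:(by left; rewrite nr)).
  have := Re_inv_ge r0 (or_intror erefl) yr' h1.
  have := Re_inv_ge r0 (or_introl erefl) yr' h2.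
  rewrite -!GE divff ?gt_eqF// !mulNr divff ?gt_eqF// !mul1r invfM.
  move=> q1 q2; rewrite invfM; lra.
by move: J0; rewrite /Im_contour; lra.
Qed.

(** Let [p] maximise [|h z|^2 (1 + e |z|^2)] on the closure of [W]. If [h]
    exceeds [m] somewhere, then [p] lies in [W] for small [e], and
    [k z = h z * (1 + e z conj(p))] has a strict maximum of its modulus at [p],
    because of the identity
    [|1 + e z conj(p)|^2 = (1 + e |z|^2) (1 + e |p|^2) - e |z - p|^2].
    The gap [e |z - p|^2] gives the ratio that the square lemma needs. *)
Lemma max_principle (W : set C) (h : C -> C) (B m : R) :
  open W -> (forall z, W z -> cmod z <= B) -> 0 <= m ->
  (forall z, W z -> derivable h z 1) -> {within closure W, continuous h} ->
  (forall z, closure W z -> ~ W z -> cmod (h z) <= m) ->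
  forall z, W z -> cmod (h z) <= m.
Proof.
move=> oW bW m0 dh ch hm z1 Wz1; rewrite leNgt; apply/negP => mz1.
set s := cmod (h z1) in mz1.
have bcW z : closure W z -> cmod z <= B.
  move=> Wz; rewrite leNgt; apply/negP => Bz.
  have [|w [Ww]] := Wz [set w | cmod (w - z) < cmod z - B].
    by apply/nbhs_cmodP; exists (cmod z - B) => //; rewrite subr_gt0.
  have := cmod_dist_trans w z 0; rewrite !subr0 cmodBC /=; have := bW _ Ww; lra.
have s0 : 0 <= s by exact: cmod_ge0.
set D := m ^+ 2 * B ^+ 2 + 1.
have D0 : 0 < D by rewrite /D; have := sqr_ge0 (m * B); rewrite exprMn; lra.
(* so small that the weight cannot lift a boundary value above [s] *)
pose e := (s ^+ 2 - m ^+ 2) / (2 * D).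
have sm : 0 < s ^+ 2 - m ^+ 2 by nra.
have e0 : 0 < e by rewrite divr_gt0// mulr_gt0.
have eD : m ^+ 2 * (1 + e * B ^+ 2) < s ^+ 2.
  have : e * (2 * D) = s ^+ 2 - m ^+ 2 by rewrite /e mulfVK// gt_eqF// mulr_gt0.
  rewrite /D; lra.
pose phi z : R := cmod (h z) ^+ 2 * (1 + e * cmod z ^+ 2).
have cphi : {within closure W, continuous phi}.
  move=> z; have c1 : {for z, continuous (fun z : subspace (closure W) => cmod (h z))}.
    exact: (@continuous_comp (subspace (closure W)) C R _ _ _ (ch z) (@continuous_cmod R _)).
  have c2 : {for z, continuous (fun z : subspace (closure W) => cmod z)}.
    have ci : {for z, continuous (fun z : subspace (closure W) => z : C)}.
      exact: (@continuous_subspaceT C C (closure W) id (fun x => cvg_id) z).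
    exact: (@continuous_comp (subspace (closure W)) C R _ _ _ ci (@continuous_cmod R _)).
  have cc (a : R) : {for z, continuous (fun _ : subspace (closure W) => a)}.
    exact: cst_continuous.
  have c3 := continuousM (cc e) (continuousM c2 c2).
  exact: (continuousM (continuousM c1 c1) (continuousD (cc 1) c3)).
have [p Wp pmax] : exists2 p, closure W p & forall t, closure W t -> phi t <= phi p.
  have cpt : compact (closure W).
    exact: compact_bounded_closed (@closed_closure _ W) bcW.
  have W0 : closure W !=set0 := ex_intro _ z1 (subset_closure Wz1).
  have [p Wp H] := compact_EVT_max W0 cpt cphi.
  by exists p => [|t Wt]; [exact: set_mem|exact/H/mem_set].
have p1 : s ^+ 2 <= phi p.
  apply: le_trans (pmax z1 (subset_closure Wz1)).
  by rewrite /phi -/s ler_peMr ?sqr_ge0// lerDl mulr_ge0 ?sqr_ge0// ltW.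
have Wp' : W p.
  apply: contrapT => nWp; have hp := hm p Wp nWp; have Bp := bcW p Wp.
  have h0 := cmod_ge0 (h p); have p0 := cmod_ge0 p.
  suff : phi p <= m ^+ 2 * (1 + e * B ^+ 2) by lra.
  rewrite /phi; apply: ler_pM; rewrite ?sqr_ge0//.
  - by rewrite addr_ge0// mulr_ge0 ?sqr_ge0// ltW.
  - by rewrite ler_pXn2r// nnegrE.
  - by rewrite lerD2l ler_pM2l// ler_pXn2r// nnegrE// (le_trans p0).
have hp0 : 0 < cmod (h p).
  rewrite lt_neqAle cmod_ge0 andbT eq_sym; apply/eqP => hp.
  by move: p1; rewrite /phi hp expr0n/= mul0r; nra.
pose k (z : C) : C := h z * (1 + (e%:C)%C * (z * (p^*)%C)).
have kE z : cmod (k z) ^+ 2 = cmod (h z) ^+ 2 *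
    ((1 + e * cmod z ^+ 2) * (1 + e * cmod p ^+ 2) - e * cmod (z - p) ^+ 2).
  rewrite cmodM exprMn; congr (_ * _); rewrite !cmod_sqr.
  by case: z {Wp pmax p1 Wp' hp0 k} => a b; case: p => c d /=; ring.
set P := 1 + e * cmod p ^+ 2.
have P1 : 1 <= P by rewrite lerDl mulr_ge0 ?sqr_ge0// ltW.
have kp : cmod (k p) ^+ 2 = phi p * P.
  by rewrite kE subrr cmod0 expr0n/= mulr0 subr0 mulrA.
have [r0 r00 Hr0] : exists2 r : R, 0 < r & forall z, cmod (z - p) < r -> W z.
  by apply/nbhs_cmodP; move: oW; rewrite openE; exact.
pose r := r0 / 3; have r_gt0 : 0 < r by rewrite divr_gt0.
have rW z : rect (Re p - r) (Re p + r) (Im p - r) (Im p + r) z -> W z.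
  move=> [/andP[? ?] /andP[? ?]]; apply: Hr0; apply: le_lt_trans (cmod_le _) _.
  rewrite ReB ImB.
  have : `|Re z - Re p| <= r by rewrite ler_norml; lra.
  have : `|Im z - Im p| <= r by rewrite ler_norml; lra.
  rewrite /r in r_gt0 *; lra.
(* [Q] bounds the weight on [W]; its last term makes [0 <= t] obvious *)
pose Q := 1 + e * B ^+ 2 + e * r ^+ 2.
have eB : 0 <= e * B ^+ 2 by rewrite mulr_ge0 ?sqr_ge0// ltW.
have er : 0 < e * r ^+ 2 by rewrite mulr_gt0// exprn_gt0.
have Q0 : 0 < Q by rewrite /Q; lra.
have P0 : 0 < P by rewrite (lt_le_trans ltr01).
have QP : 0 < Q * P by rewrite mulr_gt0.
have QPr : e * r ^+ 2 < Q * P.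
  have : Q <= Q * P by rewrite ler_peMr// ltW.
  rewrite /Q; lra.
have B0 : 0 <= B := le_trans (cmod_ge0 z1) (bW _ Wz1).
pose t := 1 - e * r ^+ 2 / (Q * P).
have tn z : W z -> r <= cmod (z - p) -> cmod (k z) ^+ 2 <= t * cmod (k p) ^+ 2.
  move=> Wz rz; rewrite kE kp -/P.
  have Z0 : 0 < 1 + e * cmod z ^+ 2.
    by rewrite ltr_wpDr// mulr_ge0 ?sqr_ge0// ltW.
  have Zq : 1 + e * cmod z ^+ 2 <= Q.
    have : e * cmod z ^+ 2 <= e * B ^+ 2.
      by rewrite ler_pM2l// ler_pXn2r ?nnegrE ?cmod_ge0// bW.
    rewrite /Q; lra.
  have rz2 : e * r ^+ 2 <= e * cmod (z - p) ^+ 2.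
    by rewrite ler_pM2l// ler_pXn2r ?nnegrE ?cmod_ge0// ltW.
  have := pmax z (subset_closure Wz); rewrite {1}/phi.
  set Z := 1 + e * cmod z ^+ 2 in Zq Z0 *.
  have H0 := sqr_ge0 (cmod (h z)).
  move: (cmod (h z) ^+ 2) H0 => H H0 h1.
  have -> : t * (phi p * P) = phi p * (P - e * r ^+ 2 / Q).
    by rewrite /t; field; rewrite !gt_eqF.
  have PQ : 0 <= P - e * r ^+ 2 / Q.
    by rewrite subr_ge0 ler_pdivrMr// (mulrC P) ltW.
  apply: le_trans (ler_wpM2r PQ h1); rewrite -(mulrA H Z); apply: ler_wpM2l => //.
  rewrite mulrBr; apply: lerB => //; apply: le_trans rz2.
  by rewrite mulrA ler_pdivrMr// mulrC ler_pM2l.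
have t01 : 0 <= t < 1.
  rewrite /t subr_ge0 ler_pdivrMr// mul1r ltW//=.
  by rewrite ltrBlDr ltrDl divr_gt0.
have pE : (Re p +i* Im p)%C = p by case: (p).
apply: (@no_strict_max_on_square k (Re p) (Im p) r (Num.sqrt t) r_gt0).
- rewrite sqrtr_ge0/= -(@ltr_pXn2r _ 2)// ?nnegrE ?sqrtr_ge0//.
  by case/andP: t01 => ? ?; rewrite sqr_sqrtr// expr1n.
- have phip : 0 < phi p.
    by rewrite (lt_le_trans _ p1)// exprn_gt0// (le_lt_trans m0 mz1).
  rewrite pE -cmod_eq0; apply/negP => /eqP kp0; move: kp.
  rewrite kp0 expr0n/= => /esym/eqP.
  by rewrite mulf_eq0 (gt_eqF phip) (gt_eqF P0).
- move=> z /rW Wz; rewrite /k.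
  have d1 := derivableCM (@derivableC_id R z) (@derivableC_cst R (p^*)%C z).
  have d2 := derivableCM (@derivableC_cst R (e%:C)%C z) d1.
  have d3 := derivableCD (@derivableC_cst R 1 z) d2.
  exact: (derivableCM (dh z Wz) d3).
- move=> z /rW Wz; rewrite pE => rz.
  rewrite -(@ler_pXn2r _ 2)// ?nnegrE ?mulr_ge0 ?sqrtr_ge0 ?cmod_ge0//.
  rewrite exprMn sqr_sqrtr; first exact: tn.
  by case/andP: t01.
Qed.

End MaximumPrinciple.

(** * Components and paths *)

Section PlaneTopology.
Variable R : realType.
Local Notation C := (Cplane R).
Implicit Types (A B S : set C) (z w l : C) (g : R -> C).

Lemma bounded_cmodP (T : Type) (f : T -> C) (A : set T) : A !=set0 ->
  [bounded f x | x in A] <-> exists M : R, forall x, A x -> cmod (f x) <= M.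
Proof.
move=> [a Aa]; have PF := globally_properfilter Aa.
split=> [/ex_bound[M H]|[M H]].
  exists (Re M) => x /H /=; rewrite normcE lecE /= => /andP[_]; exact.
by apply/ex_bound; exists (M%:C)%C => x /H /=; rewrite normcE lecR.
Qed.

Definition segm z w (t : R) : C := z + (t%:C)%C * (w - z).

Lemma continuous_segm z w : continuous (segm z w).
Proof.
move=> t; have -> : segm z w = fun t : R =>
    ((Re z + t * (Re w - Re z)) +i* (Im z + t * (Im w - Im z)))%C.
  apply/funext => s; rewrite /segm; case: z w => [? ?] [? ?].
  by apply/eqP; rewrite eq_complex/=; apply/andP; split; apply/eqP; ring.
have aff (a b : R) : {for t, continuous (fun t : R => a + t * b)}.
  have ca : {for t, continuous (fun _ : R => a)} by exact: cst_continuous.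
  have cb : {for t, continuous (fun _ : R => b)} by exact: cst_continuous.
  have ct : {for t, continuous (fun x : R => x)} by exact: cvg_id.
  exact: (continuousD ca (continuousM ct cb)).
exact: continuous_Complex (aff _ _) (aff _ _).
Qed.

Lemma segm0 z w : segm z w 0 = z.
Proof. by rewrite /segm rmorph0 mul0r addr0. Qed.
Lemma segm1 z w : segm z w 1 = w.
Proof. by rewrite /segm rmorph1 mul1r addrC subrK. Qed.

Lemma cmod_segm z w t : cmod (segm z w t - z) = `|t| * cmod (w - z).
Proof. by rewrite /segm addrC addrA addNr add0r cmodM cmodR. Qed.

Lemma connected_segm z w : connected (segm z w @` `[0, 1]).
Proof.
apply: connected_continuous_connected; first exact: segment_connected.
exact/continuous_subspaceT/continuous_segm.
Qed.

Lemma star_connected S z :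
  (forall w t, S w -> 0 <= t <= 1 -> S (segm z w t)) -> connected S.
Proof.
move=> st; have -> : S = \bigcup_(w in S) (segm z w @` `[0, 1]).
  apply/seteqP; split=> [w Sw|_ [w Sw [t /= t01 <-]]].
    by exists w => //; exists 1; rewrite ?segm1//= in_itv/= lexx ler01.
  by apply: st => //; move: t01; rewrite in_itv.
apply: bigcup_connected; last by move=> *; exact: connected_segm.
by exists z => w Sw; exists 0; rewrite ?segm0//= in_itv/= lexx ler01.
Qed.

Lemma connected_cball z (r : R) : connected [set w : C | cmod (w - z) < r].
Proof.
apply: (@star_connected _ z) => w t /= wr /andP[t0 t1].
rewrite cmod_segm ger0_norm//; apply: le_lt_trans wr.
by rewrite ler_piMl// cmod_ge0.
Qed.

(** Both local facts about components, that those of an open set are open and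
    that they contain their limit points within the set, come from this. *)
Lemma component_absorb A x z (r : R) : 0 < r ->
  (forall w, cmod (w - z) < r -> A w) ->
  (exists2 w, connected_component A x w & cmod (w - z) < r) ->
  forall w, cmod (w - z) < r -> connected_component A x w.
Proof.
move=> r0 bA [w xw wz] u uz; apply: connected_component_trans xw _.
by apply: (@connected_component_max _ A [set w : C | cmod (w - z) < r]) => //;
  exact: connected_cball.
Qed.

Lemma component_open A x : open A -> open (connected_component A x).
Proof.
move=> oA; rewrite openE => z xz; apply/nbhs_cmodP.
have /nbhs_cmodP[r r0 H] : nbhs z A.
  by move: oA; rewrite openE; apply; exact: connected_component_sub xz.
exists r => //; apply: component_absorb => //.
by exists z => //; rewrite subrr cmod0.
Qed.

Lemma closure_cmodP A z :
  closure A z <-> forall e : R, 0 < e -> exists2 w, A w & cmod (w - z) < e.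
Proof.
split=> [cz e e0|H B /nbhs_cmodP[e e0 eB]].
  have [|w [Aw we]] := cz [set w | cmod (w - z) < e]; last by exists w.
  by apply/nbhs_cmodP; exists e.
by have [w Aw we] := H e e0; exists w; split => //; exact: eB.
Qed.

Lemma open_cmod_ball A z : open A -> A z ->
  exists2 r : R, 0 < r & forall w, cmod (w - z) < r -> A w.
Proof. by rewrite openE => oA Az; apply/nbhs_cmodP; exact: oA. Qed.

Lemma component_closure A x z : open A -> A z ->
  closure (connected_component A x) z -> connected_component A x z.
Proof.
move=> oA Az /closure_cmodP cz; have [r r0 H] := open_cmod_ball oA Az.
apply: (component_absorb r0 H); last by rewrite subrr cmod0.
exact: cz.
Qed.

Lemma open_disk : open (@disk R).
Proof.
have -> : @disk R = (@cmod R) @^-1` [set x | x < 1].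
  by apply/seteqP; split=> z /diskE.
by apply: open_comp; [move=> z _; exact: continuous_cmod | exact: open_lt].
Qed.

Lemma C_hausdorff : hausdorff_space C.
Proof. exact: norm_hausdorff. Qed.

Lemma compact_trace (g : R -> C) : is_path g -> compact (trace g).
Proof. by case=> cg _ _ _; apply: continuous_compact => //; exact: segment_compact. Qed.

Lemma closed_trace (g : R -> C) : is_path g -> closed (trace g).
Proof. by move=> /compact_trace; apply: compact_closed; exact: C_hausdorff. Qed.

Lemma trace_cases g z : is_path g -> trace g z ->
  [\/ z = -1, z = 1 | exists2 s, 0 < s < 1 & z = g s /\ disk z].
Proof.
move=> [_ g0 g1 gd] [s /=]; rewrite in_itv/= => /andP[s0 s1] <-.
move: s0; rewrite le_eqVlt => /predU1P[<-|s0]; first by constructor 1.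
move: s1; rewrite le_eqVlt => /predU1P[->|s1]; first by constructor 2.
by constructor 3; exists s; rewrite ?s0 ?s1//; split => //; apply: gd; rewrite s0.
Qed.

Lemma trace_end0 g : is_path g -> trace g (-1).
Proof. by case=> _ <- _ _; exists 0 => //=; rewrite in_itv/= lexx ler01. Qed.

Lemma trace_end1 g : is_path g -> trace g 1.
Proof. by case=> _ _ <- _; exists 1 => //=; rewrite in_itv/= lexx ler01. Qed.

Lemma trace_inner g s : 0 < s < 1 -> trace g (g s).
Proof. by move=> /andP[s0 s1]; exists s => //=; rewrite in_itv/= !ltW. Qed.

Lemma cmodN1 : cmod (-1 : C) = 1.
Proof. by rewrite cmodN cmod1. Qed.

Lemma path_at_end g (e : R) : is_path g -> 0 < e ->
  exists2 s0 : R, 0 < s0 < 1 & forall s, s0 < s < 1 -> cmod (g s - 1) < e.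
Proof.
move=> [cg _ g1 _] e0.
have /subspace_continuousP/(_ 1) := cg.
rewrite /= in_itv/= lexx ler01 => /(_ isT) /cvg_cmodP /(_ _ e0).
rewrite near_withinE => /nbhs_ballP[d /= d0 H].
exists (Num.max (1 - d) (1 / 2)).
  by rewrite lt_max gt_max; apply/andP; split; [apply/orP; right|apply/andP; split]; lra.
move=> s; rewrite gt_max => /andP[/andP[s1 s2] s3].
rewrite -{1}g1; apply: H; last by rewrite in_itv/=; lra.
by rewrite -ball_normE/= ltr_norml; lra.
Qed.

(** Hence the points of a trace that are close to [1] come from parameters
    close to [1]. *)
Lemma path_away_from_end g (s0 : R) : is_path g -> 0 <= s0 < 1 ->
  exists2 d : R, 0 < d & forall s, 0 <= s <= s0 -> d <= cmod (g s - 1).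
Proof.
move=> [cg g0 g1 gd] /andP[s00 s01].
have cg0 : {within `[0, s0], continuous g}.
  apply: continuous_subspaceW cg => x /=; rewrite !in_itv/= => /andP[-> xs].
  by rewrite (le_trans xs)// ltW.
have c1 : closed (g @` `[0, s0]).
  apply: compact_closed; first exact: C_hausdorff.
  by apply: continuous_compact => //; exact: segment_compact.
have n1 : ~ (g @` `[0, s0]) 1.
  move=> [s /=]; rewrite in_itv/= le_eqVlt => /andP[/predU1P[<- _|sp ss]].
    by rewrite g0 => /(congr1 (@Re R))/=; lra.
  move=> gs1; have /diskE : disk (g s) by apply: gd; rewrite sp (le_lt_trans ss).
  by rewrite gs1 cmod1 ltxx.
have [r r0 Hr] := open_cmod_ball (closed_openC c1) n1.
exists r => // s ss; rewrite leNgt; apply/negP => /Hr; apply.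
by exists s => //=; rewrite in_itv.
Qed.

Definition tends_along (f : C -> C) (g : R -> C) (l : C) := forall e : R, 0 < e ->
  exists2 s0 : R, 0 < s0 < 1 & forall s, s0 < s < 1 -> cmod (f (g s) - l) < e.

Lemma tends_alongP f g l :
  (f (g s) @[s --> (1:R)^'-] --> l) <-> tends_along f g l.
Proof.
split=> [/cvg_cmodP H e /H|H].
  rewrite near_withinE => /nbhs_ballP[d /= d0 Hd].
  exists (Num.max (1 - d) (1 / 2)).
    by rewrite lt_max gt_max; apply/andP; split; [apply/orP; right|apply/andP; split]; lra.
  move=> s; rewrite gt_max => /andP[/andP[s1 s2] s3].
  by apply: Hd => //; rewrite -ball_normE/= ltr_norml; lra.
apply/cvg_cmodP => e /H[s0 /andP[s00 s01] Hs]; rewrite near_withinE.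
apply/nbhs_ballP; exists (1 - s0); first by rewrite /= subr_gt0.
move=> s; rewrite -ball_normE/= ltr_norml => /andP[? ?] s1; apply: Hs; lra.
Qed.

Lemma tends_near_trace f g (e : R) : is_path g -> tends_along f g 0 -> 0 < e ->
  exists2 d : R, 0 < d & forall z, trace g z -> cmod (z - 1) < d -> z != 1 ->
    cmod (f z) < e.
Proof.
move=> pg tf e0; have [s0 /andP[s00 s01] Hs] := tf e e0.
have [|d d0 Hd] := path_away_from_end pg (s0 := s0); first by rewrite ltW.
exists d => // z [s /=]; rewrite in_itv/= => /andP[sp s1] <- gd gn1.
have ss0 : s0 < s.
  by rewrite ltNge; apply/negP => ss; have := Hd s; rewrite sp ss leNgt gd => /(_ isT).
have sl1 : s < 1.
  rewrite lt_neqAle s1 andbT; apply/eqP => s1'; move: gn1; rewrite s1'.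
  by case: pg => _ _ -> _; rewrite eqxx.
by have := Hs s; rewrite subr0 ss0 sl1; exact.
Qed.

End PlaneTopology.

Section TwoPaths.
Variable R : realType.
Local Notation C := (Cplane R).
Variables g1 g2 : R -> C.
Hypotheses (pg1 : is_path g1) (pg2 : is_path g2).
Local Notation A := (~` (trace g1 `|` trace g2)).

Lemma open_compl_traces : open A.
Proof. by apply: closed_openC; apply: closedU; exact: closed_trace. Qed.

Lemma traces_cases z : (trace g1 `|` trace g2) z -> [\/ z = -1, z = 1 | disk z].
Proof.
by case=> [/(trace_cases pg1)|/(trace_cases pg2)] [->|->|[s _ [_ ?]]];
  [constructor 1|constructor 2|constructor 3|constructor 1|constructor 2|constructor 3].
Qed.

(** A component reaching outside the disk contains a radial half-line. *)
Lemma bounded_component_disk z : in_bounded_component A z ->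
  connected_component A z `<=` @disk R.
Proof.
move=> [Az bz] w zw; apply: contrapT => /diskE/negP; rewrite -leNgt => w1.
have [|M HM] := (bounded_cmodP (fun x : C => x) _).1 bz; first by exists w.
pose T : set C := [set ((t%:C)%C * w : C) | t in [set t : R | 1 <= t]].
have cw : cmod w <= M by exact: HM.
have Tsub : T `<=` connected_component A w.
  apply: connected_component_max.
  - by exists 1; rewrite /= ?lexx// mul1r.
  - move=> _ [t /= t1 <-] /traces_cases.
    have ct : cmod ((t%:C)%C * w : C) = t * cmod w.
      by rewrite cmodM cmodR ger0_norm// (le_trans ler01).
    have key : cmod ((t%:C)%C * w : C) = 1 -> t = 1 by rewrite ct; nra.
    have Aw := connected_component_sub zw.
    case=> e.
    + have t1' : t = 1 by apply: key; rewrite e cmodN1.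
      by move: e; rewrite t1' mul1r => e; apply: Aw; left; rewrite e; exact: trace_end0.
    + have t1' : t = 1 by apply: key; rewrite e cmod1.
      by move: e; rewrite t1' mul1r => e; apply: Aw; left; rewrite e; exact: trace_end1.
    + by move/diskE: e; rewrite ct; nra.
  - apply: (@star_connected _ _ w) => _ s [t /= t1 <-] /andP[s0 s1].
    exists (1 + s * (t - 1)) => /=; first by nra.
    rewrite /segm; case: (w) => a b.
    by apply/eqP; rewrite eq_complex/=; apply/andP; split; apply/eqP; ring.
have : connected_component A z (((M + 2)%:C)%C * w).
  apply: connected_component_trans zw _; apply: Tsub; exists (M + 2) => //=; lra.
move=> /HM; rewrite cmodM cmodR ger0_norm; nra.
Qed.

End TwoPaths.

(** * Decay between two paths *)

Section Decay.
Variable R : realType.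
Local Notation C := (Cplane R).

Lemma le_of_expn_le (q h c : R) : 0 < h -> 0 < c ->
  (forall n, q ^+ n * c <= 2 * h ^+ n) -> q <= h.
Proof.
move=> h0 c0 H; rewrite leNgt; apply/negP => hq.
have q0 : 0 < q by exact: lt_trans hq.
have [||n Hn] := @exists_expn_lt R (h / q) (c / 2); last 1 first.
- move: Hn; rewrite expr_div_n ltr_pdivrMr ?exprn_gt0// => Hn.
  have := H n; lra.
- by rewrite divr_ge0 ?ltW//= ltr_pdivrMr// mul1r.
- by rewrite divr_gt0.
Qed.

(** A peak function: of modulus at most 1 on the disk, equal to 1 at the point
    [1], and bounded away from 1 in modulus at a given distance from it. *)
Definition peak (z : C) : C := (1 + z) / 2.

(** The parallelogram law for [1] and [z]. *)
Lemma peak_sqr z : 4 * cmod (peak z) ^+ 2 = 2 + 2 * cmod z ^+ 2 - cmod (z - 1) ^+ 2.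
Proof.
have -> : 4 * cmod (peak z) ^+ 2 = cmod (2 * peak z) ^+ 2.
  rewrite cmodM exprMn; congr (_ * _).
  have -> : (2 : C) = ((2 : R)%:C)%C by rewrite rmorphD rmorph1.
  by rewrite cmodR ger0_norm// -natrX.
have -> : 2 * peak z = 1 + z by rewrite /peak mulrC divfK// pnatr_eq0.
by rewrite !cmod_sqr; case: z => a b /=; ring.
Qed.

Lemma derivable_peak z : derivable peak z 1.
Proof.
have d1 := derivableCD (@derivableC_cst R 1 z) (@derivableC_id R z).
exact: (derivableCM d1 (@derivableC_cst R 2^-1 z)).
Qed.

Lemma cmod_peak_le1 z : disk z -> cmod (peak z) <= 1.
Proof.
move=> /diskE z1; have := peak_sqr z; have := cmod_ge0 z; have := cmod_ge0 (peak z).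
have := sqr_ge0 (cmod (z - 1)); nra.
Qed.

Lemma near_peak N : exists2 d : R, 0 < d &
  forall z, cmod (z - 1) < d -> 1 / 2 < cmod (peak z) ^+ N.
Proof.
have cm : {for (1 : C), continuous (fun z => peak z ^+ N)}.
  exact: derivable_continuousC (@derivableCX R _ N 1 (@derivable_peak 1)).
have peak1 : peak 1 = 1 by rewrite /peak divff// pnatr_eq0.
have /cvg_cmodP /(_ (1 / 2)) := cm; rewrite peak1 expr1n => /(_ ltac:(lra)).
move=> /nbhs_cmodP[d d0 H]; exists d => // z /H; rewrite -cmodX => h.
have := cmod_dist_trans (peak z ^+ N) 1 0; rewrite !subr0 cmod1 cmodBC; lra.
Qed.

Variables g1 g2 : R -> C.
Hypotheses (pg1 : is_path g1) (pg2 : is_path g2).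
Local Notation A := (~` (trace g1 `|` trace g2)).

(** Near [1] the boundary of a bounded component of the complement consists
    of points of the traces, where [F] is small, of points at distance [d]
    from [1], where a high power of the peak function makes the product
    small, and of [1] itself, about which nothing is known. The last point is
    made harmless by applying the maximum principle to the [n]-th power of the
    product times [1 - w], and letting [n] grow. *)
Lemma small_between (F : C -> C) (M e : R) :
  (forall z, disk z -> derivable F z 1) -> (forall z, disk z -> cmod (F z) <= M) ->
  tends_along F g1 0 -> tends_along F g2 0 -> 0 < e ->
  exists2 d : R, 0 < d & forall z, region_between g1 g2 z -> cmod (z - 1) < d ->
    cmod (F z) <= e.
Proof.
move=> dF FM F1 F2 e0; pose h := e / 2; have h0 : 0 < h by rewrite divr_gt0.
have [d1 d10 H1] := tends_near_trace pg1 F1 h0.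
have [d2 d20 H2] := tends_near_trace pg2 F2 h0.
pose d := Num.min (1 / 2) (Num.min d1 d2).
have d0 : 0 < d by rewrite !lt_min d10 d20 divr_gt0.
have dl1 : d <= d1 by rewrite !ge_min lexx orbT.
have dl2 : d <= d2 by rewrite !ge_min lexx !orbT.
have d12 : d <= 1 / 2 by rewrite ge_min lexx.
have Htr z : (trace g1 `|` trace g2) z -> cmod (z - 1) < d -> z != 1 -> cmod (F z) < h.
  by case=> tz zd z1; [apply: H1 => //|apply: H2 => //]; exact: lt_le_trans zd _.
have M0 : 0 <= M.
  by apply: le_trans (cmod_ge0 _) (FM 0 _); apply/diskE; rewrite cmod0.
pose q := 1 - d ^+ 2 / 4.
have q01 : 0 <= q < 1 by rewrite /q; nra.
have [N HN] : exists N, q ^+ N < h / (M + 1).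
  by apply: exists_expn_lt => //; rewrite divr_gt0//; lra.
have MN : M * q ^+ N <= h.
  have := HN; rewrite ltr_pdivlMr; last lra.
  have : 0 <= q ^+ N by case/andP: q01 => ? _; exact: exprn_ge0.
  nra.
have [d3 d30 H3] := near_peak (2 * N).
exists (Num.min d d3); first by rewrite lt_min d0.
move=> z [zD zc]; rewrite lt_min => /andP[zd zd3].
have z1 : z != 1.
  by apply/eqP => z1; move/diskE: zD; rewrite z1 cmod1 ltxx.
suff key : cmod (F z) * cmod (peak z) ^+ (2 * N) <= h.
  have := H3 z zd3; have := cmod_ge0 (F z); rewrite /h in key *; nra.
have p1 w : disk w -> cmod (peak w) ^+ (2 * N) <= 1.
  by move=> /cmod_peak_le1 m1; apply: exprn_ile1 => //; exact: cmod_ge0.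
have case1 w : disk w -> cmod (F w) <= h -> cmod (F w) * cmod (peak w) ^+ (2 * N) <= h.
  by move=> /p1 m1 Fh; have := cmod_ge0 (F w); nra.
have case2 w : disk w -> d <= cmod (w - 1) -> cmod (F w) * cmod (peak w) ^+ (2 * N) <= h.
  move=> Dw dw; apply: le_trans MN; apply: ler_pM; rewrite ?exprn_ge0 ?cmod_ge0//.
    exact: FM.
  rewrite exprM; apply: lerXn2r; rewrite ?nnegrE ?sqr_ge0//.
    by case/andP: q01.
  move/diskE: Dw => w1; have := peak_sqr w; have := cmod_ge0 w; rewrite /q; nra.
have [tz|tz] := pselect ((trace g1 `|` trace g2) z).
  by apply: case1 => //; exact/ltW/Htr.
have bz : in_bounded_component A z by case: zc => // ?; exfalso; apply: tz; [left|right].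
have Omega_disk := bounded_component_disk pg1 pg2 bz.
set Omega := connected_component A z in Omega_disk.
have oA := open_compl_traces pg1 pg2.
pose W : set C := Omega `&` [set w | cmod (w - 1) < d].
have oW : open W.
  apply: openI; first exact: component_open.
  rewrite openE => w /= wd; apply/nbhs_cmodP; exists (d - cmod (w - 1)).
    by rewrite subr_gt0.
  by move=> u; have := cmod_dist_trans w u 1; rewrite /=; lra.
have clW w : closure W w -> closure Omega w /\ cmod (w - 1) <= d.
  move=> /closure_cmodP cw; split.
    by apply/closure_cmodP => r /cw[u [Ou _] ur]; exists u.
  rewrite leNgt; apply/negP => dw; have [|u [_ /= ud] uw] := cw (cmod (w - 1) - d).
    by rewrite subr_gt0.
  by have := cmod_dist_trans u w 1; rewrite (cmodBC w u); lra.
have clWD w : closure W w -> w = 1 \/ disk w.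
  move=> /clW[cw wd]; have [tw|Aw] := pselect ((trace g1 `|` trace g2) w).
    case: (traces_cases pg1 pg2 tw) => [wN|->|?]; [|by left|by right].
    have w2 : cmod (w - 1) = 2.
      rewrite wN -opprD cmodN; have -> : (1 + 1 : C) = ((2 : R)%:C)%C.
        by rewrite rmorphD rmorph1.
      by rewrite cmodR ger0_norm.
    by move: wd; rewrite w2 leNgt (le_lt_trans d12)//; lra.
  by right; apply: Omega_disk; exact: component_closure.
have bdW w : closure W w -> ~ W w -> w != 1 ->
    cmod (F w) * cmod (peak w) ^+ (2 * N) <= h.
  move=> cw nW w1; have Dw : disk w by case: (clWD _ cw) => // /eqP; rewrite (negPf w1).
  have [cO wd] := clW _ cw.
  have [dw|dw] := leP d (cmod (w - 1)); first exact: case2.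
  have [tw|Aw] := pselect ((trace g1 `|` trace g2) w).
    by apply: case1 => //; exact/ltW/Htr.
  by exfalso; apply: nW; split => //; exact: component_closure.
apply: (@le_of_expn_le _ _ (cmod (1 - z))) => //.
  by rewrite cmod_gt0 subr_eq0 eq_sym.
move=> n; pose G (w : C) : C := (F w * peak w ^+ (2 * N)) ^+ n * (1 - w).
have GE w : cmod (G w) = (cmod (F w) * cmod (peak w) ^+ (2 * N)) ^+ n * cmod (1 - w).
  by rewrite /G cmodM !cmodX cmodM cmodX.
have G1 : G 1 = 0 by rewrite /G subrr mulr0.
have dG w : disk w -> derivable G w 1.
  move=> Dw; have e1 := derivableCM (dF w Dw) (@derivableCX R _ (2 * N) w (@derivable_peak w)).
  have e2 := derivableCB (@derivableC_cst R 1 w) (@derivableC_id R w).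
  exact: (derivableCM (@derivableCX R _ n w e1) e2).
rewrite -GE; apply: (@max_principle R W G 1).
- exact: oW.
- by move=> w [/Omega_disk/diskE /ltW].
- by rewrite mulr_ge0// exprn_ge0// ltW.
- by move=> w [/Omega_disk /dG].
- apply/subspace_continuousP => w cw; case: (clWD w cw) => [w1|Dw]; last first.
    exact: cvg_within_filter (derivable_continuousC (dG w Dw)).
  change (G x @[x --> within (closure W) (nbhs w)] --> G w).
  have -> : G w = 0 by rewrite w1.
  rewrite w1; apply/cvg_cmodP => r r0; rewrite near_withinE; apply/nbhs_cmodP.
  have MN0 : 0 < M ^+ n + 1 by rewrite ltr_wpDl// exprn_ge0.
  exists (r / (M ^+ n + 1)); first by rewrite divr_gt0.
  move=> u ur cu; rewrite subr0; case: (clWD u cu) => [->|Du].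
    by rewrite G1 cmod0.
  rewrite GE cmodBC; move: ur; rewrite ltr_pdivlMr//; apply: le_lt_trans.
  rewrite mulrC; apply: ler_wpM2l; first exact: cmod_ge0.
  apply: le_trans (_ : M ^+ n <= _); last lra.
  apply: lerXn2r; rewrite ?nnegrE ?mulr_ge0 ?exprn_ge0 ?cmod_ge0//.
  rewrite -[leRHS]mulr1; apply: ler_pM; rewrite ?exprn_ge0 ?cmod_ge0//.
    exact: FM.
  exact: p1.
- move=> w cw nW; have [->|w1] := eqVneq w 1.
    by rewrite G1 cmod0 mulr_ge0// exprn_ge0// ltW.
  have Dw : disk w by case: (clWD _ cw) => // /eqP; rewrite (negPf w1).
  rewrite GE mulrC; apply: ler_pM; rewrite ?exprn_ge0 ?mulr_ge0 ?exprn_ge0 ?cmod_ge0//.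
    by apply: le_trans (cmodB _ _) _; rewrite cmod1; move/diskE: Dw; lra.
  apply: lerXn2r; rewrite ?nnegrE ?mulr_ge0 ?exprn_ge0 ?cmod_ge0//; first exact: ltW.
  exact: bdW.
- split => //; exact: connected_component_refl.
Qed.

End Decay.

(** * Crossing paths *)

Section GridCrossing.

Let edge (p p' q q' : bool) : int := (p'%:Z - p%:Z) * (q%:Z + q'%:Z).

(** Two colourings [P] and [Q] of a grid stand for the signs of two functions.
    The integer cochain [edge] counts the changes of [P] weighted by [Q]. Its
    sum around a cell vanishes as soon as [P] or [Q] is constant on the cell,
    while the sum around the whole grid, where the colours are prescribed, is
    [-2]; so some cell sees both colours of both. *)
Lemma grid_crossing (n : nat) (P Q : nat -> nat -> bool) :
  (forall j, (j <= n)%N -> P 0%N j = false /\ P n j = true) ->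
  (forall i, (i <= n)%N -> Q i 0%N = false /\ Q i n = true) ->
  exists i j, [/\ (i < n)%N, (j < n)%N &
    let corner k l := (i <= k <= i.+1)%N && (j <= l <= j.+1)%N in
    ((exists k l, corner k l /\ P k l) /\ (exists k l, corner k l /\ ~~ P k l)) /\
    ((exists k l, corner k l /\ Q k l) /\ (exists k l, corner k l /\ ~~ Q k l))].
Proof.
move=> Pb Qb.
pose H i j := edge (P i j) (P i.+1 j) (Q i j) (Q i.+1 j).
pose V i j := edge (P i j) (P i j.+1) (Q i j) (Q i j.+1).
pose cell i j := H i j + V i.+1 j - H i j.+1 - V i j.
have total : \sum_(0 <= i < n) \sum_(0 <= j < n) cell i j = - 2%:Z.
  have -> : \sum_(0 <= i < n) \sum_(0 <= j < n) cell i j =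
      \sum_(0 <= i < n) \sum_(0 <= j < n) (H i j - H i j.+1) +
      \sum_(0 <= j < n) \sum_(0 <= i < n) (V i.+1 j - V i j).
    rewrite [X in _ = _ + X]exchange_big -big_split /=; apply: eq_bigr => i _.
    by rewrite -big_split /=; apply: eq_bigr => j _; rewrite /cell; lia.
  have -> : \sum_(0 <= j < n) \sum_(0 <= i < n) (V i.+1 j - V i j) = 0.
    rewrite big_nat_cond big1// => j /andP[/andP[_ jn] _].
    rewrite telescope_sumr// /V /edge.
    have [-> ->] := Pb j (ltnW jn); have [-> ->] := Pb j.+1 jn.
    by lia.
  rewrite addr0 (eq_big_nat _ _ (F2 := fun i => - (2%:Z * ((P i.+1 n)%:Z - (P i n)%:Z)))).
    rewrite sumrN -mulr_sumr telescope_sumr//.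
    by have [-> ->] := Pb n (leqnn n); rewrite subr0 mulr1.
  move=> i /andP[_ iN].
  have -> : \sum_(0 <= j < n) (H i j - H i j.+1) = - \sum_(0 <= j < n) (H i j.+1 - H i j).
    by rewrite -sumrN; apply: eq_bigr => j _; rewrite opprB.
  rewrite telescope_sumr// /H /edge.
  have [-> ->] := Qb i (ltnW iN); have [-> ->] := Qb i.+1 iN.
  by rewrite addr0 mulr0 subr0 mulrC.
have [[i [j [iN jN cij]]]|none] :=
    pselect (exists i j, [/\ (i < n)%N, (j < n)%N & cell i j != 0]); last first.
  exfalso; move: total; rewrite big_nat_cond big1// => i /andP[/andP[_ iN] _].
  rewrite big_nat_cond big1// => j /andP[/andP[_ jN] _].
  by apply/eqP; apply: contrapT => /negP cij; apply: none; exists i, j.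
exists i, j; split => // corner.
have c00 : corner i j by rewrite /corner !leqnn !leqnSn.
have c10 : corner i.+1 j by rewrite /corner !leqnn !leqnSn.
have c01 : corner i j.+1 by rewrite /corner !leqnn !leqnSn.
have c11 : corner i.+1 j.+1 by rewrite /corner !leqnn !leqnSn.
have pick (S : nat -> nat -> bool) :
    ~~ [&& S i j == S i.+1 j, S i j == S i j.+1 & S i j == S i.+1 j.+1] ->
    (exists k l, corner k l /\ S k l) /\ (exists k l, corner k l /\ ~~ S k l).
  case s00: (S i j); case s10: (S i.+1 j); case s01: (S i j.+1);
  case s11: (S i.+1 j.+1) => //= _; split;
  (by exists i, j; rewrite s00) || (by exists i.+1, j; rewrite s10) ||
  (by exists i, j.+1; rewrite s01) || (by exists i.+1, j.+1; rewrite s11).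
split; apply: pick; apply: contra_neqN cij => /and3P[/eqP e1 /eqP e2 /eqP e3];
  by rewrite /cell /H /V /edge -e1 -e2 -e3; ring.
Qed.

End GridCrossing.

Section Crossing.
Variable R : realType.
Local Notation C := (Cplane R).

Lemma compact_closed_dist (K1 K2 : set C) : compact K1 -> closed K2 ->
  K1 `&` K2 = set0 ->
  exists2 d : R, 0 < d & forall x y, K1 x -> K2 y -> d <= cmod (x - y).
Proof.
move=> /compact_near_coveringP cK1 cK2 K120.
have [|N _ /(_ N (leqnn N)) H] := cK1 nat \oo
    (fun n x => forall y, K2 y -> n.+1%:R^-1 <= cmod (x - y)) _.
  move=> x K1x; have K2x : ~ K2 x by move=> K2x; suff: set0 x by []; rewrite -K120.
  have [r r0 Hr] := open_cmod_ball (closed_openC cK2) K2x.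
  have r2 : 0 < r / 2 by rewrite divr_gt0.
  exists ([set w | cmod (w - x) < r / 2], [set n | n.+1%:R^-1 < r / 2]).
    split; first by apply/nbhs_cmodP; exists (r / 2).
    exact: (near_infty_natSinv_lt (PosNum r2)).
  move=> [w n] /= [wx nr] y K2y; rewrite leNgt; apply/negP => wy.
  apply: (Hr y _ K2y); apply: le_lt_trans (cmod_dist_trans w y x) _.
  by rewrite (cmodBC y w) (splitr r); apply: ltrD => //; exact: lt_trans nr.
exists N.+1%:R^-1; first by rewrite invr_gt0.
by move=> x y K1x K2y; exact: H.
Qed.

Lemma path_unif_continuous (a : R -> C) (e : R) : {within `[0, 1], continuous a} -> 0 < e ->
  exists N : nat, forall n, (N <= n)%N -> forall s t, 0 <= s <= 1 -> 0 <= t <= 1 ->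
    `|s - t| <= n.+1%:R^-1 -> cmod (a s - a t) < e.
Proof.
move=> ca e0; have /compact_near_coveringP c01 := @segment_compact R 0 1.
have [|N _ H] := c01 nat \oo (fun n x => forall y, 0 <= x <= 1 -> 0 <= y <= 1 ->
  `|x - y| <= n.+1%:R^-1 -> cmod (a x - a y) < e) _.
  move=> x x01; have /subspace_continuousP/(_ x x01)/cvg_cmodP := ca.
  have e2 : 0 < e / 2 by rewrite divr_gt0.
  move=> /(_ _ e2); rewrite near_withinE => /nbhs_ballP[d /= d0 Hd].
  have d2 : 0 < d / 2 by rewrite divr_gt0.
  exists ([set w | `|x - w| < d / 2], [set n | n.+1%:R^-1 < d / 2]).
    split; last exact: (near_infty_natSinv_lt (PosNum d2)).
    by apply/nbhs_ballP; exists (d / 2).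
  move=> [w n] /= [wx nd] y w01 y01 wy.
  have xw : ball x d w by rewrite -ball_normE/=; lra.
  have xy : ball x d y.
    rewrite -ball_normE/=; apply: le_lt_trans (ler_distD w _ _) _.
    by rewrite (splitr d); apply: ltrD => //; exact: le_lt_trans wy nd.
  have := Hd w xw; rewrite in_itv/= => /(_ w01).
  have := Hd y xy; rewrite in_itv/= => /(_ y01).
  have := cmod_dist_trans (a x) (a w) (a y); rewrite (cmodBC (a x) (a y)); lra.
exists N => n Nn s t s01 t01; exact: H.
Qed.

(** Two paths joining opposite sides of a rectangle meet: otherwise their
    distance is positive, and on a fine grid the signs of the real and
    imaginary parts of [a s - b t] satisfy the hypotheses of [grid_crossing];
    in the cell it provides, [a s - b t] is too small. *)
Lemma paths_cross (a b : R -> C) :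
  {within `[0, 1], continuous a} -> {within `[0, 1], continuous b} ->
  (forall t, 0 <= t <= 1 -> Re (a 0) <= Re (b t) <= Re (a 1)) ->
  (forall s, 0 <= s <= 1 -> Im (b 0) <= Im (a s) <= Im (b 1)) ->
  exists s t, [/\ 0 <= s <= 1, 0 <= t <= 1 & a s = b t].
Proof.
move=> ca cb bRe aIm; apply: contrapT => nomeet.
have [|||d d0 Hd] := @compact_closed_dist (a @` `[0, 1]) (b @` `[0, 1]).
- exact: (continuous_compact ca (@segment_compact R 0 1)).
- apply: compact_closed; first exact: C_hausdorff.
  exact: (continuous_compact cb (@segment_compact R 0 1)).
- apply/seteqP; split => // z [[s /= s01 <-] [t /= t01 bt]]; apply: nomeet.
  by exists s, t; rewrite in_itv/= in s01; rewrite in_itv/= in t01.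
have d6 : 0 < d / 6 by rewrite divr_gt0.
have [Na Ha] := path_unif_continuous ca d6; have [Nb Hb] := path_unif_continuous cb d6.
pose n := maxn Na Nb; pose pt (i : nat) : R := i%:R / n.+1%:R.
have n0 : 0 < n.+1%:R :> R by [].
have pt01 i : (i <= n.+1)%N -> 0 <= pt i <= 1.
  by move=> iN; rewrite divr_ge0//= ler_pdivrMr// mul1r ler_nat.
have pt0 : pt 0%N = 0 by rewrite /pt mul0r.
have pt1 : pt n.+1 = 1 by rewrite /pt divff// gt_eqF.
have ptS i k l : (i <= k <= i.+1)%N -> (i <= l <= i.+1)%N ->
    `|pt k - pt l| <= n.+1%:R^-1.
  have ni : 0 < n.+1%:R^-1 :> R by rewrite invr_gt0.
  move=> ik il; rewrite /pt -mulrBl normrM (gtr0_norm ni).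
  rewrite ler_piMl ?(ltW ni)// ler_norml.
  have [k1 k2] : i%:R <= k%:R :> R /\ k%:R <= i%:R + 1 :> R.
    by rewrite natr1 !ler_nat; case/andP: ik.
  have [l1 l2] : i%:R <= l%:R :> R /\ l%:R <= i%:R + 1 :> R.
    by rewrite natr1 !ler_nat; case/andP: il.
  lra.
pose D i j := a (pt i) - b (pt j).
(* on the boundary the sign may be zero, so the colour there is imposed *)
pose P i j := (i == n.+1) || ((i != 0%N) && (0 < Re (D i j))).
pose Q i j := (j == n.+1) || ((j != 0%N) && (Im (D i j) < 0)).
have PT i j : (j <= n.+1)%N -> P i j -> 0 <= Re (D i j).
  move=> /pt01/bRe /andP[_ h]; rewrite /P => /orP[/eqP ->|/andP[_ /ltW//]].
  by rewrite /D pt1 ReB subr_ge0.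
have PF i j : (j <= n.+1)%N -> ~~ P i j -> Re (D i j) <= 0.
  move=> /pt01/bRe /andP[h _]; rewrite /P negb_or negb_and negbK -leNgt.
  by move=> /andP[_ /orP[/eqP -> |//]]; rewrite /D pt0 ReB subr_le0.
have QT i j : (i <= n.+1)%N -> Q i j -> Im (D i j) <= 0.
  move=> /pt01/aIm /andP[_ h]; rewrite /Q => /orP[/eqP ->|/andP[_ /ltW//]].
  by rewrite /D pt1 ImB subr_le0.
have QF i j : (i <= n.+1)%N -> ~~ Q i j -> 0 <= Im (D i j).
  move=> /pt01/aIm /andP[h _]; rewrite /Q negb_or negb_and negbK -leNgt.
  by move=> /andP[_ /orP[/eqP -> |//]]; rewrite /D pt0 ImB subr_ge0.
have [||i [j [iN jN]]] := @grid_crossing n.+1 P Q.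
- by move=> j jn; rewrite /P !eqxx.
- by move=> i iN; rewrite /Q !eqxx.
set corner := fun k l => _ => /= -[[[k1 [l1 [c1 P1]]] [k2 [l2 [c2 P2]]]]].
move=> [[k3 [l3 [c3 Q3]]] [k4 [l4 [c4 Q4]]]].
have bnd k l : corner k l -> (k <= n.+1)%N /\ (l <= n.+1)%N.
  by rewrite /corner => /andP[/andP[_ h1] /andP[_ h2]]; split;
    [exact: leq_trans h1 iN|exact: leq_trans h2 jN].
have close k l k' l' : corner k l -> corner k' l' ->
    cmod (D k l - D k' l') < d / 3.
  move=> c c'; have [kN lN] := bnd _ _ c; have [kN' lN'] := bnd _ _ c'.
  have /andP[ck cl] := c; have /andP[ck' cl'] := c'.
  have -> : D k l - D k' l' = (a (pt k) - a (pt k')) - (b (pt l) - b (pt l')).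
    by rewrite /D !opprD !opprK addrACA.
  apply: le_lt_trans (cmodB _ _) _.
  have := Ha n (leq_maxl _ _) _ _ (pt01 _ kN) (pt01 _ kN') (ptS _ _ _ ck ck').
  have := Hb n (leq_maxr _ _) _ _ (pt01 _ lN) (pt01 _ lN') (ptS _ _ _ cl cl').
  clear; lra.
have [k1N l1N] := bnd _ _ c1; have [k2N l2N] := bnd _ _ c2.
have [k3N l3N] := bnd _ _ c3; have [k4N l4N] := bnd _ _ c4.
have r1 := PT _ _ l1N P1; have r2 := PF _ _ l2N P2.
have r3 := QT _ _ k3N Q3; have r4 := QF _ _ k4N Q4.
have h1 : d <= cmod (D k1 l1).
  by apply: Hd; [exists (pt k1)|exists (pt l1)] => //=; rewrite in_itv/=; exact: pt01.
have h2 := le_lt_trans (normr_Re _) (close _ _ _ _ c1 c2).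
have h3 := le_lt_trans (normr_Im _) (close _ _ _ _ c1 c3).
have h4 := le_lt_trans (normr_Im _) (close _ _ _ _ c1 c4).
have h5 := le_trans h1 (cmod_le _).
move: h2 h3 h4; rewrite !(ReB (D _ _), ImB (D _ _)) !ltr_norml => h2 h3 h4.
have h6 : `|Re (D k1 l1)| <= d / 3 by rewrite ler_norml; clear -h2 r1 r2; lra.
have h7 : `|Im (D k1 l1)| <= d / 3.
  by rewrite ler_norml; clear -h3 h4 r3 r4; lra.
clear -d0 h5 h6 h7; lra.
Qed.

End Crossing.

(** * Separation in the disk *)

Section Links.
Variable R : realType.
Local Notation C := (Cplane R).
Implicit Types (S T : set C) (z w q : C) (g : R -> C).

(** Being constant outside [0, 1] makes concatenation a sum of two
    reparametrized paths, hence obviously continuous. *)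
Definition linked T z w := exists b : R -> C,
  [/\ continuous b, forall t, t <= 0 -> b t = z, forall t, 1 <= t -> b t = w &
      forall t, T (b t)].

Lemma linked_trans T w z u : linked T z w -> linked T w u -> linked T z u.
Proof.
move=> [b [cb bz bw bT]] [c [cc cw cu cT]].
pose d (t : R) : C := b (2 * t) + c (2 * t - 1) - w.
have dl t : t <= 1 / 2 -> d t = b (2 * t).
  by move=> t2; rewrite /d cw; [rewrite addrK|lra].
have dr t : 1 / 2 <= t -> d t = c (2 * t - 1).
  by move=> t2; rewrite /d bw; [rewrite addrAC subrr add0r|lra].
exists d; split.
- move=> t; have cst (k : R) : {for t, continuous (fun _ : R => k)} by exact: cst_continuous.
  have cid : {for t, continuous (fun x : R => x)} by exact: cvg_id.
  have c2 := continuousM (cst 2) cid.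
  have c3 := continuousB c2 (cst 1).
  have cb' : {for t, continuous (fun x : R => b (2 * x))}.
    exact: (continuous_comp c2 (cb _)).
  have cc' : {for t, continuous (fun x : R => c (2 * x - 1))}.
    exact: (continuous_comp c3 (cc _)).
  have cw' : {for t, continuous (fun _ : R => w)} by exact: cst_continuous.
  exact: (continuousB (continuousD cb' cc') cw').
- by move=> t t0; rewrite dl ?bz//; lra.
- by move=> t t1; rewrite dr ?cu//; lra.
- move=> t; have [t2|/ltW t2] := leP t (1 / 2); first by rewrite dl.
  by rewrite dr.
Qed.

Lemma linked_sym T z w : linked T z w -> linked T w z.
Proof.
move=> [b [cb bz bw bT]]; exists (fun t => b (1 - t)); split.
- move=> t; have c1 : {for t, continuous (fun _ : R => 1 : R)} by exact: cst_continuous.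
  have cid : {for t, continuous (fun x : R => x)} by exact: cvg_id.
  exact: (continuous_comp (continuousB c1 cid) (cb _)).
- by move=> t t0; apply: bw; lra.
- by move=> t t1; apply: bz; lra.
- by move=> t; exact: bT.
Qed.

Lemma linked_segm T z w : (forall t, 0 <= t <= 1 -> T (segm z w t)) -> linked T z w.
Proof.
move=> zwT; pose clamp (t : R) : R := (1 + `|t| - `|t - 1|) / 2.
have cl0 t : t <= 0 -> clamp t = 0.
  by move=> t0; rewrite /clamp !ler0_norm//; lra.
have cl1 t : 1 <= t -> clamp t = 1.
  by move=> t1; rewrite /clamp !ger0_norm//; lra.
have cl01 t : 0 <= clamp t <= 1.
  by rewrite /clamp; case: (ger0P t); case: (ger0P (t - 1)); lra.
exists (fun t => segm z w (clamp t)); split.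
- move=> t; have cst (k : R) : {for t, continuous (fun _ : R => k)} by exact: cst_continuous.
  have cid : {for t, continuous (fun x : R => x)} by exact: cvg_id.
  have n1 : {for t, continuous (fun x : R => `|x|)} by exact: norm_continuous.
  have n2 : {for t, continuous (fun x : R => `|x - 1|)}.
    exact: (continuous_comp (continuousB cid (cst 1)) (@norm_continuous _ _ _)).
  have n3 := continuousM (continuousB (continuousD (cst 1) n1) n2) (cst 2^-1).
  exact: (continuous_comp n3 (@continuous_segm _ z w _)).
- by move=> t t0; rewrite cl0// segm0.
- by move=> t t1; rewrite cl1// segm1.
- by move=> t; apply: zwT.
Qed.

Lemma linked_refl T z : T z -> linked T z z.
Proof. by move=> Tz; exists (fun=> z); split=> [t||t _|] //; exact: cst_continuous. Qed.

Lemma linked_sub S T z w : S `<=` T -> linked S z w -> linked T z w.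
Proof. move=> ST [b [cb bz bw bS]]; exists b; split; [exact: cb|exact: bz|exact: bw|].
by move=> t; exact/ST/bS. Qed.

Lemma linked_ball T z w (r : R) : (forall u, cmod (u - z) < r -> T u) ->
  cmod (w - z) < r -> linked T z w.
Proof.
move=> zT wr; apply: linked_segm => t /andP[t0 t1]; apply: zT.
rewrite cmod_segm ger0_norm//; apply: le_lt_trans wr.
by rewrite ler_piMl// cmod_ge0.
Qed.

Lemma open_connected_linked S z w : open S -> connected S -> S z -> S w -> linked S z w.
Proof.
move=> oS cS Sz Sw; pose B := [set u | S u /\ linked S z u].
suff : B = S by move=> BS; have [] : B w by rewrite BS.
apply: cS.
- by exists z; split => //; exact: linked_refl.
- exists B; last by apply/seteqP; split=> u; [move=> [? ?]|move=> []].
  rewrite openE => u [Su zu]; apply/nbhs_cmodP; have [r r0 Hr] := open_cmod_ball oS Su.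
  exists r => // v vr; split; first exact: Hr.
  exact: linked_trans zu (linked_ball Hr vr).
- exists (~` (S `\` B)); last first.
    apply/seteqP; split=> u; first by move=> [? ?]; split => // -[_]; apply.
    by move=> [Su nu]; apply: contrapT => nB; apply: nu.
  apply: open_closedC; rewrite openE => u [Su nu]; apply/nbhs_cmodP.
  have [r r0 Hr] := open_cmod_ball oS Su.
  exists r => // v vr; split; first exact: Hr.
  move=> [_ zv]; apply: nu; split => //.
  exact: linked_trans zv (linked_sym (linked_ball Hr vr)).
Qed.

Lemma trace_cmod_le1 g z : is_path g -> trace g z -> cmod z <= 1.
Proof.
move=> pg /(trace_cases pg)[->|->|[s _ [_ /diskE/ltW//]]].
  by rewrite cmodN1.
by rewrite cmod1.
Qed.

Lemma trace_outside g z : is_path g -> 1 <= cmod z -> Im z != 0 -> ~ trace g z.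
Proof.
move=> pg z1 Iz /(trace_cases pg)[zE|zE|[s _ [_ /diskE]]].
- by move: Iz; rewrite zE /= oppr0 eqxx.
- by move: Iz; rewrite zE /= eqxx.
- by rewrite ltNge z1.
Qed.

(** From a point of the circle off the real axis one can leave the disk
    vertically, up to height 1, because a path meets the circle only at [-1]
    and [1]. *)
Lemma link_exit g S q (sg : R) : is_path g -> S `<=` @disk R -> S `&` trace g = set0 ->
  cmod q = 1 -> sg ^+ 2 = 1 -> 0 < sg * Im q -> closure S q ->
  exists2 s, S s &
    linked ([set z : C | -1 <= Re z <= 1] `&` ~` trace g) s (Re q +i* sg)%C.
Proof.
move=> pg SD Sg q1 sg1 sgq /closure_cmodP cq.
have Iq : Im q != 0 by apply: contraTneq sgq => ->; rewrite mulr0 ltxx.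
have ng : ~ trace g q by apply: trace_outside; rewrite ?q1.
have [r r0 Hr] := open_cmod_ball (closed_openC (closed_trace pg)) ng.
have [s Ss sr] := cq r r0; exists s => //.
have Rq : -1 <= Re q <= 1 by rewrite -ler_norml -q1 normr_Re.
have Rs : -1 <= Re s <= 1.
  by rewrite -ler_norml (le_trans (normr_Re _))// ltW//; exact/diskE/SD.
apply: (@linked_trans _ q).
  apply: linked_sym; apply: linked_segm => t /andP[t0 t1]; split.
    change (is_true (-1 <= Re (segm q s t) <= 1)).
    have -> : Re (segm q s t) = Re q + t * (Re s - Re q).
      by rewrite /segm; case: (q) (s) => [? ?] [? ?] /=; ring.
    by move: Rq Rs => /= /andP[? ?] /andP[? ?]; nra.
  apply: Hr; rewrite cmod_segm ger0_norm//; apply: le_lt_trans sr.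
  by rewrite ler_piMl// cmod_ge0.
apply: linked_segm => t /andP[t0 t1].
have -> : segm q (Re q +i* sg)%C t = (Re q +i* (Im q + t * (sg - Im q)))%C.
  rewrite /segm; case: (q) => a b.
  by apply/eqP; rewrite eq_complex/=; apply/andP; split; apply/eqP; ring.
split=> //; have q2 : Re q ^+ 2 + Im q ^+ 2 = 1 by rewrite -cmod_sqr q1 expr1n.
have sq : sg * Im q <= 1 by have := sqr_ge0 (Re q); nra.
set y := Im q + _.
have yE : sg * y = sg * Im q + t * (1 - sg * Im q) by rewrite /y -sg1; ring.
have sy : sg * Im q <= sg * y by rewrite yE; nra.
apply: trace_outside => //; last first.
  by rewrite /=; apply: contraTneq sgq => y0; move: sy; rewrite y0 mulr0 -leNgt.
have y2 : Im q ^+ 2 <= y ^+ 2.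
  have e1 : Im q ^+ 2 = (sg * Im q) ^+ 2 by rewrite exprMn sg1 mul1r.
  have e2 : y ^+ 2 = (sg * y) ^+ 2 by rewrite exprMn sg1 mul1r.
  by rewrite e1 e2; nra.
rewrite -(@ler_pXn2r _ 2)// ?nnegrE ?cmod_ge0// expr1n cmod_sqr /=; lra.
Qed.

(** A path from [-1] to [1] separates the upper arc of the circle from the
    lower one: a connected open set touching both contains a path which,
    prolonged vertically at both ends, crosses the strip [-1 <= Re z <= 1] from
    bottom to top, while [g] crosses it from left to right. *)
Lemma disk_separation g S q q' : is_path g -> open S -> connected S ->
  S `<=` @disk R -> S `&` trace g = set0 ->
  cmod q = 1 -> 0 < Im q -> closure S q ->
  cmod q' = 1 -> Im q' < 0 -> closure S q' -> False.
Proof.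
move=> pg oS cS SD Sg q1 Iq cq q1' Iq' cq'.
have [||s Ss sp] := @link_exit g S q 1 pg SD Sg q1 _ _ cq; rewrite ?expr1n ?mul1r//.
have [||s' Ss' sp'] := @link_exit g S q' (-1) pg SD Sg q1' _ _ cq'.
- by rewrite sqrrN expr1n.
- by rewrite mulN1r oppr_gt0.
set T := _ `&` _ in sp sp'.
have ST : S `<=` T.
  move=> z Sz; split.
    by rewrite /= -ler_norml (le_trans (normr_Re _))// ltW//; exact/diskE/SD.
  by move=> gz; have : set0 z by rewrite -Sg.
have [b [cb b0 b1 bT]] : linked T (Re q' +i* -1)%C (Re q +i* 1)%C.
  apply: linked_trans (linked_sym sp') (linked_trans _ sp).
  exact: linked_sub ST (open_connected_linked oS cS Ss' Ss).
have [cg g0 g1 gd] := pg.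
have [t t01|s1 s01|s1 [t [s01 t01 gb]]] := paths_cross cg (continuous_subspaceT cb).
- by rewrite g0 g1; have [] := bT t.
- rewrite b0// b1//= -ler_norml; apply: le_trans (normr_Im _) _.
  by apply: (trace_cmod_le1 pg); exists s1 => //=; rewrite in_itv.
by have [_] := bT t; apply; exists s1 => //=; rewrite in_itv.
Qed.

(** A component of the complement of two paths that leaves the disk has to
    touch the circle first: if its part [Y] in the disk does not, then [Y] is
    clopen in it. *)
Lemma enclosed_bounded_component g1 g2 z : is_path g1 -> is_path g2 ->
  disk z -> ~ (trace g1 `|` trace g2) z ->
  (forall q, cmod q = 1 -> Im q != 0 ->
    ~ closure (connected_component (@disk R `\` (trace g1 `|` trace g2)) z) q) ->
  in_bounded_component (~` (trace g1 `|` trace g2)) z.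
Proof.
move=> pg1 pg2 Dz nz H; have oA := open_compl_traces pg1 pg2.
set A := ~` _ in nz oA *; set Y := connected_component _ _ in H.
have oD : open (@disk R `\` (trace g1 `|` trace g2)) by apply: openI => //; exact: open_disk.
have Yz : Y z by exact: connected_component_refl.
have oY : open Y by exact: component_open.
have YD : Y `<=` @disk R `\` (trace g1 `|` trace g2) by exact: connected_component_sub.
have YA : Y `<=` connected_component A z.
  by apply: connected_component_max => //; [move=> w /YD[]|exact: component_connected].
have YE : Y = connected_component A z.
  apply: component_connected; first by exists z.
    by exists Y => //; rewrite setIidr.
  exists (closure Y); first exact: closed_closure.
  apply/seteqP; split=> [w Yw|w [/connected_component_sub Aw cw]].
    by split; [exact: YA|exact: subset_closure].
  suff Dw : disk w by apply: component_closure.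
  apply/diskE; rewrite lt_neqAle; apply/andP; split; last first.
    rewrite leNgt; apply/negP => w1; have /closure_cmodP/(_ (cmod w - 1)) := cw.
    rewrite subr_gt0 => /(_ w1)[u /YD[/diskE u1 _]].
    by have := cmod_dist_trans u w 0; rewrite !subr0 cmodBC; lra.
  apply/eqP => w1; have [Iw|Iw] := eqVneq (Im w) 0; last exact: H cw.
  have : Re w ^+ 2 = 1 by have := cmod_sqr w; rewrite w1 Iw expr1n expr0n addr0.
  move=> /eqP; rewrite sqrf_eq1 => /orP[/eqP Rw|/eqP Rw]; apply: Aw; left.
    have -> : w = 1 by apply/eqP; rewrite eq_complex Rw Iw /= !eqxx.
    exact: trace_end1.
  have -> : w = -1 by apply/eqP; rewrite eq_complex Rw Iw /= oppr0 !eqxx.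
  exact: trace_end0.
split => //; rewrite -YE; apply/bounded_cmodP; first by exists z.
by exists 1 => w /YD[/diskE/ltW].
Qed.

End Links.

(** * Limits between two paths *)

Section Reflection.
Variable R : realType.
Local Notation C := (Cplane R).
Implicit Types (g : R -> C) (z w q a b : C).

Lemma continuous_conj : continuous (fun z : C => (z^*)%C : C).
Proof.
have -> : (fun z : C => (z^*)%C : C) = (fun z : C => (Re z -i* Im z)%C : C).
  by apply/funext => -[].
move=> z; apply: continuous_Complex; first exact: continuous_Re.
have cI : {for z, continuous (@Im R : C -> R)} by exact: continuous_Im.
exact: (@continuousN R R C _ _ cI).
Qed.

Definition conj_path g : R -> C := fun s => (g s)^*%C.

Lemma conj_path_is_path g : is_path g -> is_path (conj_path g).
Proof.
move=> [cg g0 g1 gd]; split.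
- apply/subspace_continuousP => s s01.
  move/subspace_continuousP: cg => /(_ s s01) cgs.
  exact: (cvg_comp _ _ cgs (@continuous_conj _)).
- by rewrite /conj_path g0; apply/eqP; rewrite eq_complex /= !oppr0 !eqxx.
- by rewrite /conj_path g1; apply/eqP; rewrite eq_complex /= !oppr0 !eqxx.
- by move=> s /gd /diskE sd; apply/diskE; rewrite cmod_conj.
Qed.

Lemma conj_path_trace g z : trace (conj_path g) z <-> trace g (z^*)%C.
Proof.
split=> [[s s01 <-]|[s s01 gs]]; exists s => //.
  by rewrite /conj_path conjcK.
by rewrite /conj_path gs conjcK.
Qed.

(** A path and its mirror image enclose the diameter: the component of a real
    point is symmetric, so a leak through the upper arc is also a leak through
    the lower one. *)
Lemma diameter_between g (x : R) : is_path g -> -1 < x < 1 ->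
  region_between g (conj_path g) (x%:C)%C.
Proof.
move=> pg x1; have pg' := conj_path_is_path pg.
have Dx : disk ((x%:C)%C : C) by apply/diskE; rewrite cmodR ltr_norml.
split => //; have [t1|t1] := pselect (trace g (x%:C)%C); first by constructor 1.
have [t2|t2] := pselect (trace (conj_path g) (x%:C)%C); first by constructor 2.
constructor 3; apply: enclosed_bounded_component => //; first by case.
set D := _ `\` _; set Y := connected_component D _ => q q1 Iq cq.
have oD : open D.
  by apply: openI; [exact: open_disk | exact: open_compl_traces].
have Yx : Y (x%:C)%C by apply: connected_component_refl; split => // -[].
have Dconj z : D z -> D (z^*)%C.
  move=> [/diskE zd nz]; split; first by apply/diskE; rewrite cmod_conj.
  case=> [tz|/conj_path_trace]; last by rewrite conjcK => tz; apply: nz; left.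
  by apply: nz; right; exact/conj_path_trace.
have Yconj z : Y z -> Y (z^*)%C.
  move=> Yz; pose Y' : set C := (fun z : C => (z^*)%C : C) @` Y.
  suff : Y' `<=` Y by apply; exists z.
  apply: connected_component_max.
  - by exists (x%:C)%C => //=; rewrite oppr0.
  - by move=> _ [w /connected_component_sub Dw <-]; exact: Dconj.
  - apply: connected_continuous_connected; first exact: component_connected.
    exact/continuous_subspaceT/continuous_conj.
have cq' : closure Y (q^*)%C.
  move/closure_cmodP: cq => cq; apply/closure_cmodP => e /cq[w Yw we].
  exists (w^*)%C; first exact: Yconj.
  suff -> : ((w^*)%C - (q^*)%C : C) = ((w - q)^*)%C by rewrite cmod_conj.
  case: (w) (q) => [? ?] [? ?].
  by apply/eqP; rewrite eq_complex/=; apply/andP; split; apply/eqP; ring.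
have YD : Y `<=` @disk R by move=> z /connected_component_sub[].
have Yg : Y `&` trace g = set0.
  by apply/seteqP; split => // z [/connected_component_sub[_ nz] gz]; apply: nz; left.
have oY : open Y by exact: component_open.
have cY : connected Y by exact: component_connected.
have q1' : cmod ((q^*)%C : C) = 1 by rewrite cmod_conj.
have Iq' : Im ((q^*)%C : C) = - Im q by case: (q).
have [I0|I0|I0] := ltgtP (Im q) 0; last by rewrite I0 eqxx in Iq.
  by apply: (disk_separation pg oY cY YD Yg q1' _ cq' q1 I0 cq); rewrite Iq' oppr_gt0.
by apply: (disk_separation pg oY cY YD Yg q1 I0 cq q1' _ cq'); rewrite Iq' oppr_lt0.
Qed.

(** Lindelof's theorem. For [f1 = f - a] the product of [f1] and its reflection
    in the real axis is small along the path, where the first factor is, and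
    along the mirror image of the path, where the second one is. Hence it is
    small on the diameter, which these two paths enclose; and there it has
    modulus [|f1|^2]. *)
Lemma radial_limit (f : C -> C) (M : R) g a :
  analytic_on_disk f -> (forall z, disk z -> cmod (f z) <= M) ->
  is_path g -> tends_along f g a -> forall e : R, 0 < e ->
  exists2 d : R, 0 < d & forall x : R, -1 < x < 1 -> 1 - d < x ->
    cmod (f (x%:C)%C - a) <= e.
Proof.
move=> df fM pg fa e e0.
pose f1 (z : C) : C := f z - a; pose h (z : C) : C := f1 z * (f1 (z^*)%C)^*%C.
have D0 : disk (0 : C) by apply/diskE; rewrite cmod0.
have Dconj (z : C) : disk z -> disk ((z^*)%C : C).
  by move=> /diskE zd; apply/diskE; rewrite cmod_conj.
pose M1 := M + cmod a.
have f1M z : disk z -> cmod (f1 z) <= M1.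
  by move=> /fM h1; apply: le_trans (cmodB _ _) _; rewrite lerD2r.
have M10 : 0 <= M1 by exact: le_trans (cmod_ge0 _) (f1M 0 D0).
have df1 z : disk z -> derivable f1 z 1.
  by move=> Dz; exact: (derivableCB (df z Dz) (@derivableC_cst R a z)).
have dh z : disk z -> derivable h z 1.
  by move=> Dz; exact: (derivableCM (df1 z Dz) (derivableC_conj (df1 _ (Dconj z Dz)))).
have hE z : cmod (h z) = cmod (f1 z) * cmod (f1 (z^*)%C).
  by rewrite /h cmodM cmod_conj.
have hM z : disk z -> cmod (h z) <= M1 * M1.
  move=> Dz; rewrite hE; apply: ler_pM; rewrite ?cmod_ge0//; first exact: f1M.
  exact/f1M/Dconj.
have [_ _ _ gd] := pg.
have h1 : tends_along h g 0.
  move=> e' e'0; have [|s0 s001 H] := fa (e' / (M1 + 1)).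
    by rewrite divr_gt0//; lra.
  exists s0 => // s ss; have s01 : 0 < s < 1 by lra.
  have := H s ss; rewrite subr0 hE ltr_pdivlMr; last lra.
  apply: le_lt_trans; apply: ler_pM; rewrite ?cmod_ge0//.
  by apply: le_trans (f1M _ (Dconj _ (gd s s01))) _; rewrite lerDl.
have h2 : tends_along h (conj_path g) 0.
  move=> e' /h1[s0 s001 H]; exists s0 => // s ss.
  by have := H s ss; rewrite !subr0 !hE /conj_path conjcK mulrC.
have e2 : 0 < e ^+ 2 by rewrite exprn_gt0.
have [d d0 Hd] := small_between pg (conj_path_is_path pg) dh hM h1 h2 e2.
exists d => // x x1 xd; have := Hd _ (diameter_between pg x1).
have -> : ((x%:C)%C - 1 : C) = ((x - 1)%:C)%C by rewrite rmorphB rmorph1.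
rewrite cmodR ltr_norml => /(_ ltac:(lra)); rewrite hE.
have -> : ((x%:C)^*)%C = (x%:C)%C by rewrite /= oppr0.
rewrite -expr2 ler_pXn2r// nnegrE ?cmod_ge0//; exact: ltW.
Qed.

(** Both limits agree with the radial one. *)
Lemma path_limits_eq (f : C -> C) (M : R) g1 g2 a b :
  analytic_on_disk f -> (forall z, disk z -> cmod (f z) <= M) ->
  is_path g1 -> is_path g2 -> tends_along f g1 a -> tends_along f g2 b -> a = b.
Proof.
move=> df fM pg1 pg2 fa fb; apply/eqP; rewrite -subr_eq0; apply: contrapT => /negP.
rewrite -cmod_gt0 => ab; pose e := cmod (a - b) / 3.
have e0 : 0 < e by rewrite divr_gt0.
have [d1 d10 H1] := radial_limit df fM pg1 fa e0.
have [d2 d20 H2] := radial_limit df fM pg2 fb e0.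
pose d := Num.min 1 (Num.min d1 d2).
have d0 : 0 < d by rewrite !lt_min d10 d20 ltr01.
have dl : [/\ d <= 1, d <= d1 & d <= d2] by rewrite !ge_min !lexx !orbT.
have [dl0 dl1 dl2] := dl; pose x := 1 - d / 2.
have x1 : -1 < x < 1 by rewrite /x; lra.
have := H1 x x1 ltac:(rewrite /x; lra); have := H2 x x1 ltac:(rewrite /x; lra).
have := cmod_dist_trans (f (x%:C)%C) a b; rewrite (cmodBC a (f _)) /e.
rewrite /e in e0; lra.
Qed.

Lemma limit_between (f : C -> C) (M : R) g1 g2 a b :
  analytic_on_disk f -> (forall z, disk z -> cmod (f z) <= M) ->
  is_path g1 -> is_path g2 -> tends_along f g1 a -> tends_along f g2 b ->
  f z @[z --> within (region_between g1 g2) (nbhs (1 : C))] --> a.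
Proof.
move=> df fM pg1 pg2 fa fb; have ab := path_limits_eq df fM pg1 pg2 fa fb.
rewrite -{}ab in fb.
have dF z : disk z -> derivable (fun w => f w - a) z 1.
  by move=> Dz; exact: (derivableCB (df z Dz) (@derivableC_cst R a z)).
have FM z : disk z -> cmod (f z - a) <= M + cmod a.
  by move=> /fM h1; apply: le_trans (cmodB _ _) _; rewrite lerD2r.
have F1 g : tends_along f g a -> tends_along (fun w => f w - a) g 0.
  by move=> fg e /fg[s0 s001 H]; exists s0 => // s /H; rewrite subr0.
apply/cvg_cmodP => e e0; have e2 : 0 < e / 2 by rewrite divr_gt0.
have [d d0 Hd] := small_between pg1 pg2 dF FM (F1 _ fa) (F1 _ fb) e2.
rewrite near_withinE; apply/nbhs_cmodP; exists d => // z zd zr.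
apply: le_lt_trans (Hd z zr zd) _; lra.
Qed.

Lemma boundary_at_1 (K : set C) : K `<=` @disk R -> closure K 1 -> boundary K 1.
Proof.
move=> KD cK; split => // /interior_subset /KD /diskE.
by rewrite cmod1 ltxx.
Qed.

Lemma region_between_boundary g1 g2 : is_path g1 -> boundary (region_between g1 g2) 1.
Proof.
move=> pg; apply: boundary_at_1; first by move=> z [].
apply/closure_cmodP => e e0; have [s0 /andP[s00 s01] H] := path_at_end pg e0.
pose s := (s0 + 1) / 2; have s1 : s0 < s < 1 by rewrite /s; lra.
exists (g1 s); last exact: H.
have s01' : 0 < s < 1 by lra.
by split; [case: pg => _ _ _; exact | constructor 1; exact: trace_inner].
Qed.

End Reflection.

Section AboveBelow.
Variable R : realType.
Local Notation C := (Cplane R).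
Implicit Types (g : R -> C) (z w q : C).

(** The point of the unit circle at angle [th] from [1], measured upwards for
    [sg = 1] and downwards for [sg = -1]. *)
Definition arc (sg th : R) : C := (cos th +i* (sg * sin th))%C.

Lemma cmod_arc sg th : sg ^+ 2 = 1 -> cmod (arc sg th) = 1.
Proof.
move=> sg1; apply/eqP; rewrite -(@eqrXn2 _ 2)// ?cmod_ge0// cmod_sqr /=.
by rewrite exprMn sg1 mul1r cos2Dsin2 expr1n.
Qed.

Lemma continuous_arc sg : continuous (arc sg).
Proof.
move=> t; have ccos : {for t, continuous (@cos R)} by exact: continuous_cos.
have cs : {for t, continuous (fun _ : R => sg)} by exact: cst_continuous.
have csin : {for t, continuous (@sin R)} by exact: continuous_sin.
exact: (continuous_Complex ccos (continuousM cs csin)).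
Qed.

(** Follow the circle from near [1] to the point [0 +i* sg], at a constant
    distance from the circle smaller than the distance to [g] of the arc in
    question, and then go radially to [0 +i* sg]. *)
Lemma touching_boundary g (sg : R) : is_path g -> sg ^+ 2 = 1 ->
  boundary (component_touching g (0 +i* sg)%C) 1.
Proof.
move=> pg sg1; apply: boundary_at_1; first by move=> z [[]].
apply/closure_cmodP => e e0.
have e2 : 0 < e / 2 by rewrite divr_gt0.
have [th /andP[th0 thpi] thd] :
    exists2 th : R, 0 < th <= pi / 2 & cmod (arc sg th - 1) < e / 2.
  have /cvg_cmodP/(_ _ e2)/nbhs_ballP[d /= d0 Hd] := @continuous_arc sg 0.
  have arc0 : arc sg 0 = 1 by rewrite /arc cos0 sin0 mulr0.
  have p0 := @pi_gt0 R.
  exists (Num.min (d / 2) (pi / 2)).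
    by rewrite lt_min ge_min lexx orbT andbT !divr_gt0.
  suff : cmod (arc sg (Num.min (d / 2) (pi / 2)) - arc sg 0) < e / 2 by rewrite arc0.
  apply: Hd; rewrite -ball_normE/= sub0r normrN ger0_norm.
    by rewrite gt_min; apply/orP; left; lra.
  by rewrite le_min !divr_ge0// ltW.
have [|d d0 Hd] := compact_closed_dist
    (continuous_compact (continuous_subspaceT (@continuous_arc sg))
      (@segment_compact _ th (pi / 2))) (closed_trace pg).
  apply/seteqP; split => // _ [[t /= + <-]].
  rewrite in_itv/= => /andP[t1 t2]; apply: trace_outside => //.
    by rewrite cmod_arc.
  rewrite /arc/= mulf_neq0//; first by rewrite -sqrf_eq0 sg1 oner_eq0.
  rewrite gt_eqF// sin_gt0_pi//; have := @pi_gt0 R; lra.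
pose ep := Num.min (1 / 2) (Num.min (d / 2) (e / 2)).
have ep0 : 0 < ep by rewrite !lt_min !divr_gt0.
have [ep1 ep2 ep3] : [/\ ep <= 1 / 2, ep <= d / 2 & ep <= e / 2].
  by rewrite !ge_min !lexx !orbT.
pose ray (rho t : R) : C := (rho%:C)%C * arc sg t.
have rayD rho t : 0 < rho < 1 -> disk (ray rho t).
  move=> /andP[r0 r1]; apply/diskE.
  by rewrite cmodM cmod_arc// cmodR mulr1 gtr0_norm.
have ray_dist rho t : rho <= 1 -> cmod (arc sg t - ray rho t) = 1 - rho.
  move=> r1; have -> : arc sg t - ray rho t = ((1 - rho)%:C)%C * arc sg t.
    by rewrite /ray rmorphB rmorph1 mulrBl mul1r.
  by rewrite cmodM cmod_arc// cmodR mulr1 ger0_norm// subr_ge0.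
have rayT rho t : 1 - ep <= rho < 1 -> th <= t <= pi / 2 ->
    (@disk R `\` trace g) (ray rho t).
  move=> /andP[r1 r2] t1; split; first by apply: rayD; lra.
  move=> tr; have : d <= cmod (arc sg t - ray rho t).
    by apply: Hd => //; exists t => //=; rewrite in_itv.
  rewrite ray_dist; last exact: ltW.
  lra.
pose r0 := 1 - ep; pose z := ray r0 th.
have r01 : 1 - ep <= r0 < 1 by rewrite /r0; lra.
have thin : th <= th <= pi / 2 by rewrite lexx.
have pin : th <= (pi : R) / 2 <= (pi : R) / 2 by rewrite thpi lexx.
exists z; last first.
  apply: le_lt_trans (cmod_dist_trans (arc sg th) _ _) _.
  rewrite cmodBC /z ray_dist; last by rewrite /r0; lra.
  rewrite /r0; lra.
have Dz : (@disk R `\` trace g) z by exact: rayT.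
split => //; split; last first.
  move=> /interior_subset /connected_component_sub[/diskE + _].
  by rewrite /cmod/= expr0n add0r sg1 sqrtr1 ltxx.
have Yarc : connected_component (@disk R `\` trace g) z (ray r0 (pi / 2)).
  pose K : set C := ray r0 @` `[th, pi / 2].
  have KY : K `<=` connected_component (@disk R `\` trace g) z.
    apply: connected_component_max.
    - by exists th => //=; rewrite in_itv.
    - by move=> _ [t /= + <-]; rewrite in_itv/=; exact: rayT.
    - apply: connected_continuous_connected; first exact: segment_connected.
      apply: continuous_subspaceT => t.
      have cr : {for t, continuous (fun _ : R => (r0%:C)%C : C)} by exact: cst_continuous.
      have ca : {for t, continuous (arc sg)} by exact: continuous_arc.
      exact: (continuousM cr ca).
  by apply: KY; exists (pi / 2) => //=; rewrite in_itv/= thpi lexx.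
have arcpi : arc sg (pi / 2) = (0 +i* sg)%C by rewrite /arc cos_pihalf sin_pihalf mulr1.
have Yray rho : r0 <= rho < 1 ->
    connected_component (@disk R `\` trace g) z (ray rho (pi / 2)).
  move=> /andP[h1 h2]; apply: connected_component_trans Yarc _.
  pose K : set C := segm (ray r0 (pi / 2)) (ray rho (pi / 2)) @` `[0, 1].
  have KY : K `<=` connected_component (@disk R `\` trace g) (ray r0 (pi / 2)).
    apply: connected_component_max.
    - by exists 0; rewrite ?segm0//= in_itv/= lexx ler01.
    - move=> _ [t /= + <-]; rewrite in_itv/= => /andP[t0 t1].
      have -> : segm (ray r0 (pi / 2)) (ray rho (pi / 2)) t =
          ray (r0 + t * (rho - r0)) (pi / 2).
        rewrite /segm /ray; case: (arc _ _) => x y.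
        by apply/eqP; rewrite eq_complex/=; apply/andP; split; apply/eqP; ring.
      apply: rayT => //; apply/andP; split; rewrite /r0 in h1 *; clear -h1 h2 t0 t1; nra.
    - exact: connected_segm.
  by apply: KY; exists 1; rewrite ?segm1//= in_itv/= lexx ler01.
apply/closure_cmodP => c c0; pose rho := 1 - Num.min ep (c / 2).
have m0 : 0 < Num.min ep (c / 2) by rewrite lt_min ep0 divr_gt0.
have [m1 m2] : Num.min ep (c / 2) <= ep /\ Num.min ep (c / 2) <= c / 2.
  by split; rewrite ge_min lexx ?orbT.
exists (ray rho (pi / 2)); first by apply: Yray; rewrite /rho /r0; clear -m0 m1; lra.
rewrite -arcpi cmodBC ray_dist /rho; clear -m0 m2 c0; lra.
Qed.

End AboveBelow.

(** * The two sides of a path *)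

Section Trapped.
Variable R : realType.
Local Notation C := (Cplane R).
Implicit Types (g : R -> C) (S : set C) (z w q : C).

Lemma disk_separation_sign g S q q' (sg : R) : sg = 1 \/ sg = -1 ->
  is_path g -> open S -> connected S ->
  S `<=` @disk R -> S `&` trace g = set0 ->
  cmod q = 1 -> 0 < sg * Im q -> closure S q ->
  cmod q' = 1 -> sg * Im q' < 0 -> closure S q' -> False.
Proof.
move=> [] -> pg oS cS SD Sg q1 Iq cq q1' Iq' cq'.
  rewrite mul1r in Iq; rewrite mul1r in Iq'.
  exact: (disk_separation pg oS cS SD Sg q1 Iq cq q1' Iq' cq').
rewrite mulN1r oppr_gt0 in Iq; rewrite mulN1r oppr_lt0 in Iq'.
exact: (disk_separation pg oS cS SD Sg q1' Iq' cq' q1 Iq cq).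
Qed.

Lemma cmod_i (sg : R) : sg = 1 \/ sg = -1 -> cmod ((0 +i* sg)%C : C) = 1.
Proof. by case=> ->; rewrite /cmod/= expr0n add0r ?sqrrN expr1n sqrtr1. Qed.

Lemma open_disk_minus_trace g : is_path g -> open (@disk R `\` trace g).
Proof.
by move=> pg; apply: openI; [exact: open_disk|exact/closed_openC/closed_trace].
Qed.

Lemma connected_disk : connected (@disk R).
Proof.
have -> : @disk R = [set w : C | cmod (w - 0) < 1].
  by apply/seteqP; split=> w; rewrite /= subr0 => /diskE.
exact: connected_cball.
Qed.

(** Otherwise the component would be clopen in the disk. *)
Lemma component_meets_path g z : is_path g -> (@disk R `\` trace g) z ->
  exists2 s, 0 < s < 1 &
    closure (connected_component (@disk R `\` trace g) z) (g s).
Proof.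
move=> pg Dz; apply: contrapT => none; have oD := open_disk_minus_trace pg.
set S := connected_component _ _ in none.
have SD : S `<=` @disk R `\` trace g by exact: connected_component_sub.
have half : 0 < (1 / 2 : R) < 1 by lra.
have [_ _ _ gd] := pg.
suff SE : S = @disk R.
  have : S (g (1 / 2)) by rewrite SE; exact: gd.
  by move=> /SD[_]; apply; exact: trace_inner.
apply: connected_disk; first by exists z; exact: connected_component_refl.
  exists S; first exact: component_open.
  by rewrite setIidr// => w /SD[].
exists (closure S); first exact: closed_closure.
apply/seteqP; split=> w; first by move=> Sw; split; [have [] := SD _ Sw|exact: subset_closure].
move=> [Dw cw]; have [tw|tw] := pselect (trace g w).
  exfalso; case: (trace_cases pg tw) => [wE|wE|[s s01 [wE _]]].
  - by move/diskE: Dw; rewrite wE cmodN1 ltxx.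
  - by move/diskE: Dw; rewrite wE cmod1 ltxx.
  - by apply: none; exists s; [exact: s01|rewrite -wE].
exact: component_closure.
Qed.

(** Let [gs] and [go] stay on the two sides of [g]. A connected open set [S]
    that contains [g] without its end points and avoids [gs] cannot touch the
    circle on the side of [gs]: united with the component [O] of a point of
    [go], which it meets near a point of [g], it would touch both arcs and
    still avoid [gs]. *)
Lemma no_escape g gs go S q (sg : R) : sg = 1 \/ sg = -1 ->
  is_path g -> is_path gs -> is_path go ->
  (forall s, 0 < s < 1 -> component_touching g (0 +i* sg)%C (gs s)) ->
  (forall s, 0 < s < 1 -> component_touching g (0 +i* - sg)%C (go s)) ->
  open S -> connected S -> S `<=` @disk R -> S `&` trace gs = set0 ->
  (forall s, 0 < s < 1 -> S (g s)) ->
  cmod q = 1 -> 0 < sg * Im q -> ~ closure S q.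
Proof.
move=> sgE pg pgs pgo Hs Ho oS cS SD Sgs Sg q1 Iq cq.
have sg2 : sg * sg = 1 by case: sgE => ->; rewrite ?mulr1// mulrNN mulr1.
have sgE' : - sg = 1 \/ - sg = -1 by case: sgE => ->; [right|left]; rewrite ?opprK.
have half : 0 < (1 / 2 : R) < 1 by lra.
have [Do [cO _]] := Ho _ half.
set O := connected_component _ _ in cO.
have oO : open O by apply: component_open; exact: open_disk_minus_trace.
have cnO : connected O by exact: component_connected.
have OD : O `<=` @disk R by move=> w /connected_component_sub[].
have Og : O `&` trace g = set0.
  by apply/seteqP; split=> // w [/connected_component_sub[]].
have Ogs : O `&` trace gs = set0.
  apply/seteqP; split=> // w [Ow /(trace_cases pgs)[wE|wE|[s s01 [wE _]]]].
  - by have /diskE := OD _ Ow; rewrite wE cmodN1 ltxx.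
  - by have /diskE := OD _ Ow; rewrite wE cmod1 ltxx.
  - have [_ [cs _]] := Hs s s01; rewrite wE in Ow.
    rewrite -(same_connected_component Ow) -/O in cs.
    apply: (disk_separation_sign sgE pg oO cnO OD Og _ _ cs _ _ cO).
    + exact: cmod_i.
    + by rewrite /= sg2.
    + exact: cmod_i.
    + by rewrite /= mulrN sg2 oppr_lt0.
have [s s01 cgs] := component_meets_path pg Do.
have [r r0 Hr] := open_cmod_ball oS (Sg s s01).
have [u Ou ur] := (closure_cmodP _ _).1 cgs r r0.
have cU : connected (S `|` O).
  by apply: connectedU => //; exists u; split => //; exact: Hr.
have UD : S `|` O `<=` @disk R by rewrite subUset.
have Ugs : (S `|` O) `&` trace gs = set0 by rewrite setIUl Sgs Ogs setU0.
apply: (disk_separation_sign sgE pgs (openU oS oO) cU UD Ugs q1 Iq _ _ _ _).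
- by apply: closureS cq; exact: subsetUl.
- exact: (cmod_i sgE').
- by rewrite /= mulrN sg2 oppr_lt0.
- by apply: closureS cO; exact: subsetUr.
Qed.

(** A component of the complement of [ga] and [gb] that contains a point of
    [g] contains all of [g] but its end points, and thus cannot escape on either side. *)
Lemma path_between_sides g ga gb : is_path g -> is_path ga -> is_path gb ->
  (forall s, 0 < s < 1 -> component_touching g (0 +i* 1)%C (ga s)) ->
  (forall s, 0 < s < 1 -> component_touching g (0 +i* -1)%C (gb s)) ->
  forall s, 0 < s < 1 -> region_between ga gb (g s).
Proof.
move=> pg pga pgb Ha Hb s s01; have [cg _ _ gd] := pg.
have offg h t : is_path h -> 0 < t < 1 ->
    (forall s, 0 < s < 1 -> ~ trace g (h s)) -> ~ trace h (g t).
  move=> ph t01 H /(trace_cases ph)[gE|gE|[s' s01' [gE _]]].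
  - by have /diskE := gd t t01; rewrite gE cmodN1 ltxx.
  - by have /diskE := gd t t01; rewrite gE cmod1 ltxx.
  - by apply: (H s' s01'); rewrite -gE; exact: trace_inner.
have nab t : 0 < t < 1 -> ~ (trace ga `|` trace gb) (g t).
  by move=> t01 []; apply: offg => // s' /[dup] s01'; [move=> /Ha[[]]|move=> /Hb[[]]].
split; first exact: gd.
constructor 3; apply: enclosed_bounded_component => //; [exact: gd|exact: nab|].
set D := _ `\` _; set Y := connected_component D _ => q q1 Iq.
have YD : Y `<=` D by exact: connected_component_sub.
have oY : open Y.
  by apply: component_open; apply: openI; [exact: open_disk|exact: open_compl_traces].
have cY : connected Y by exact: component_connected.
have YDk : Y `<=` @disk R by move=> w /YD[].
have Yga : Y `&` trace ga = set0.
  by apply/seteqP; split=> // w [/YD[_ n] ?]; apply: n; left.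
have Ygb : Y `&` trace gb = set0.
  by apply/seteqP; split=> // w [/YD[_ n] ?]; apply: n; right.
have Yg t : 0 < t < 1 -> Y (g t).
  move=> t01; pose K : set C := g @` `]0, 1[.
  have KY : K `<=` Y.
    apply: connected_component_max.
    - by exists s => //=; rewrite in_itv.
    - move=> _ [t' /= + <-]; rewrite in_itv/= => t01'; split; first exact: gd.
      exact: nab.
    - apply: connected_continuous_connected.
        by apply/connected_intervalP; exact: interval_is_interval.
      apply: continuous_subspaceW cg => x /=; rewrite !in_itv/= => /andP[? ?].
      by rewrite !ltW.
  by apply: KY; exists t => //=; rewrite in_itv.
have [I0|I0|I0] := ltgtP (Im q) 0; last by rewrite I0 eqxx in Iq.
  have Iq' : 0 < -1 * Im q by rewrite mulN1r oppr_gt0.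
  have Ha' t : 0 < t < 1 -> component_touching g (0 +i* - -1)%C (ga t).
    by move=> t01; rewrite opprK; exact: Ha.
  exact: (no_escape (or_intror erefl) pg pgb pga Hb Ha' oY cY YDk Ygb Yg q1 Iq').
have Iq' : 0 < 1 * Im q by rewrite mul1r.
exact: (no_escape (or_introl erefl) pg pga pgb Ha Hb oY cY YDk Yga Yg q1 Iq').
Qed.

End Trapped.

Theorem theorem1p1 (R : realType) (f : Cplane R -> Cplane R)
    (g1 g2 g3 : R -> Cplane R) :
  analytic_on_disk f ->
  [bounded f z | z in @disk R] ->
  is_path g1 -> is_path g2 -> is_path g3 ->
  has_limit_along f g1 ->
  has_limit_along f g2 ->
  ~ has_limit_along f g3 ->
  convergence_set f (region_between g1 g2) /\
  (path_divergence_set f (region_above g3) \/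
   path_divergence_set f (region_below g3)).
Proof.
move=> df bf p1 p2 p3 [a fa] [b fb] nlim.
have D0 : @disk R !=set0 by exists 0; apply/diskE; rewrite cmod0.
have [M fM] := (bounded_cmodP f D0).1 bf.
move/tends_alongP: fa => fa; move/tends_alongP: fb => fb.
split.
  split; [by move=> z []|exact: region_between_boundary|exists a].
  exact: (limit_between df fM p1 p2 fa fb).
have aboveE : region_above g3 = component_touching g3 (0 +i* 1)%C by [].
have belowE : region_below g3 = component_touching g3 (0 +i* -1)%C.
  rewrite /region_below; congr component_touching.
  by apply/eqP; rewrite eq_complex /= oppr0 !eqxx.
have RD q : component_touching g3 q `<=` @disk R by move=> z [[]].
have [Pa|nPa] := pselect (exists ga, [/\ is_path ga,
    (forall s, 0 < s < 1 -> region_above g3 (ga s)) & has_limit_along f ga]); last first.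
  left; split; [exact: RD|by rewrite aboveE; apply: touching_boundary; rewrite ?expr1n|].
  by move=> ga pga Ha fla; exact: (nPa (ex_intro _ ga (And3 pga Ha fla))).
right; split; [exact: RD|by rewrite belowE; apply: touching_boundary; rewrite ?sqrrN ?expr1n|].
move=> gb pgb Hb [b' /tends_alongP flb]; apply: nlim.
have [ga [pga Ha [a' /tends_alongP fla]]] := Pa.
rewrite belowE in Hb; have between := path_between_sides p3 pga pgb Ha Hb.
have /cvg_cmodP lim := limit_between df fM pga pgb fla flb.
exists a'; apply/tends_alongP => e e0.
have := lim e e0; rewrite near_withinE => /nbhs_cmodP[d d0 Hd].
have [s0 s001 H] := path_at_end p3 d0; exists s0; [exact: s001|move=> s ss].
have s01 : 0 < s < 1 by lra.
by apply: Hd; [exact: H|exact: between].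
Qed.
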